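(* There exists a Turing machine $M_0$ recognizing a recursively enumerable non-recursive set $X$ of words in the binary alphabet such that for every real $\alpha>0$ the set of all $h_\alpha$-good numbers for $M_0$ is infinite, where $h_\alpha(n)=2^{2^{\alpha n}}$.
   Context: Let $X$ be a recursively enumerable language in the binary alphabet recognized by a Turing machine $M$ (i.e. $X$ is the set of input words accepted by $M$). For $w\in X$, $\mathrm{time}(w)$ is the minimal time (number of steps) of an accepting computation of $M$ with input $w$; $\|w\|$ is the length of $w$. For an increasing function $h$ on $\mathbb{N}$, a number $m\in\mathbb{N}$ is called $h$-good for $M$ if for every word $w\in X$ with $\|w\|<m$ we have $h(\mathrm{time}(w))<m$. *)

(* Defs.v *)
From HB Require Import structures.
From mathcomp Require Import all_boot all_order all_algebra.
From mathcomp Require Import all_classical all_reals all_analysis.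
Set Implicit Arguments.
Unset Strict Implicit.
Unset Printing Implicit Defensive.
Import Order.TTheory GRing.Theory Num.Theory.
Local Open Scope ring_scope.

(* Nondeterministic multi-tape Turing machines over the binary input alphabet,
   with two-way infinite tapes. *)
Inductive move := MoveLeft | Stay | MoveRight.

Definition shift (d : move) : int :=
  match d with MoveLeft => -1 | Stay => 0 | MoveRight => 1 end.

(* There are [extra_tapes.+1] tapes, the input tape being number [ord0].
   [trans q v (q', v', d)] holds when, in state [q] with the heads reading the
   symbols [v], the machine may write [v'], move the heads by [d] and enter
   state [q'].  There are finitely many such commands, because states and
   symbols range over finite types.  An empty set of applicable commands means
   that the machine halts, as it does in its accepting state. *)
Record TM : Type := MkTM {
  extra_tapes : nat;
  state : finType;
  symbol : finType;
  blank : symbol;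
  letter : bool -> symbol;
  start : state;
  accept : state;
  trans : state -> {ffun 'I_extra_tapes.+1 -> symbol} ->
          state * {ffun 'I_extra_tapes.+1 -> symbol}
                * {ffun 'I_extra_tapes.+1 -> move} -> bool;
  letter_inj : injective letter;
  letter_neq_blank : forall b, letter b != blank;
  accept_halts : forall v a, ~~ trans accept v a
}.

Notation tape_index M := 'I_(extra_tapes M).+1.
Notation command M :=
  (state M * {ffun tape_index M -> symbol M} * {ffun tape_index M -> move})%type.

Record config (M : TM) : Type := Config {
  cstate : state M;
  content : tape_index M -> int -> symbol M;
  head : tape_index M -> int
}.

Definition scanned (M : TM) (c : config M) : {ffun tape_index M -> symbol M} :=
  [ffun i => content c i (head c i)].

Definition perform (M : TM) (a : command M) (c : config M) : config M :=
  let: (q, v, d) := a in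
  Config q
    (fun i z => if z == head c i then v i else content c i z)
    (fun i => head c i + shift (d i)).

Definition step (M : TM) (c c' : config M) : Prop :=
  exists2 a : command M,
    trans (cstate c) (scanned c) a & c' = perform a c.

Fixpoint computes_in (M : TM) (n : nat) (c c' : config M) : Prop :=
  if n is n'.+1 then exists2 c1, step c c1 & computes_in n' c1 c'
  else c = c'.

(* The input word occupies the cells [0, ..., size w - 1] of the input tape,
   and every head starts at cell [0]. *)
Definition initial (M : TM) (w : seq bool) : config M :=
  Config (start M)
    (fun i z =>
       if (i == ord0) && (0 <= z)
       then nth (blank M) (map (@letter M) w) `|z|%N
       else blank M)
    (fun=> 0).

Definition accepts_in (M : TM) (w : seq bool) (n : nat) : Prop :=
  exists2 c : config M, computes_in n (initial M w) c & cstate c = accept M.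

Definition accepts (M : TM) (w : seq bool) : Prop :=
  exists n, accepts_in M w n.

Definition language (M : TM) : set (seq bool) := [set w | accepts M w]%classic.

Definition recognizes (M : TM) (X : set (seq bool)) : Prop := X = language M.

Definition recursively_enumerable (X : set (seq bool)) : Prop :=
  exists M : TM, recognizes M X.

Definition deterministic (M : TM) : Prop :=
  forall q v a a', trans q v a -> trans q v a' -> a = a' :> command M.

Definition halts (M : TM) (w : seq bool) : Prop :=
  exists n (c : config M),
    computes_in n (initial M w) c /\ ~ (exists c', step c c').

Definition recursive (X : set (seq bool)) : Prop :=
  exists M : TM,
    [/\ deterministic M, forall w, halts M w & recognizes M X].

Lemma accepts_asbool (M : TM) (w : seq bool) :
  accepts M w -> exists n, `[< accepts_in M w n >].
Proof. by case=> n hn; exists n; apply/asboolP. Qed.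

Definition time (M : TM) (w : seq bool) (hw : accepts M w) : nat :=
  ex_minn (accepts_asbool hw).

Definition good (R : realType) (h : nat -> R) (M : TM) (m : nat) : Prop :=
  forall (w : seq bool) (hw : accepts M w),
    (size w < m)%N -> h (time hw) < m%:R.

Definition double_exp (R : realType) (alpha : R) (n : nat) : R :=
  2 `^ (2 `^ (alpha * n%:R)).

(* [good] is only meant for increasing functions. *)
Lemma double_exp_increasing (R : realType) (alpha : R) :
  0 < alpha -> {homo double_exp alpha : m n / (m < n)%N >-> m < n}.
Proof.
move=> a0 m n mn.
have two1 : (1 : R) < 2 by rewrite ltr1n.
have mono (x y : R) : x < y -> (2 : R) `^ x < 2 `^ y.
  move=> xy; rewrite /powR pnatr_eq0 /= ltr_expR ltr_pM2r //.
  exact: ln_gt0.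
by apply/mono/mono; rewrite ltr_pM2l // ltr_nat.
Qed.

(* Main.v *)
(** Let [v_0, v_1, ...] be an injective sequence of numbers.  Call a stage [s]
    deficient if some later stage [t] has [v_t < v_s]; there are infinitely many
    true (non-deficient) stages, and the deficiency of any stage before a true
    stage [s] is witnessed no later than [s].  Choose lengths [N_0 < N_1 < ...],
    where [N_s] exceeds [2^(2^(2^c))] for [c] the time needed to compute [v_s],
    and let [X] consist of the words [w] such that [N_{s-1} < |w| <= N_s] for
    some deficient [s].  If [s] is a true stage, the words of [X] of length less
    than [N_s] are thus accepted in time [O(c)], so [N_s] is good as soon as [s]
    is large.

    The sequence [v] diagonalizes against all deciders of [X]: the value
    [2e + 1] is output, at most once, when the machine coded by [e] has been seen
    to reject a word of length [N_s] for some earlier [s] with [v_s > 2e + 1].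
    This makes [s] deficient, hence the machine wrong.  Conversely, a machine
    deciding [X] rejects such words for all true [s], so it would be caught.

    The enumeration is performed by a counter program that also counts its own
    steps, which gives the lengths [N_s]; its arithmetic is compiled from
    primitive recursive terms.  Turing machines are simulated through traces
    of commands: the symbol under a head is the last one written at its
    position. *)

From HB Require Import structures.
Require Import Defs.
From mathcomp Require Import all_boot all_order all_algebra.
From mathcomp Require Import all_classical all_reals all_analysis.
From mathcomp Require Import zify.
Set Implicit Arguments.
Unset Strict Implicit.
Unset Printing Implicit Defensive.

(** * Primitive recursive terms *)

(** Variables are de Bruijn indices; the step of [Rec] sees the accumulator as variable 0 and the
    counter as variable 1. *)
Inductive term :=
  | Var of nat | Zero | Succ of term | Let of term & term
  | Rec of term & term & term.

Fixpoint prec (b : nat) (s : nat -> nat -> nat) (n : nat) : nat :=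
  if n is k.+1 then s k (prec b s k) else b.

Fixpoint eval (t : term) (env : seq nat) : nat :=
  match t with
  | Var i => nth 0 env i
  | Zero => 0
  | Succ t1 => (eval t1 env).+1
  | Let t1 t2 => eval t2 (eval t1 env :: env)
  | Rec n b s =>
      prec (eval b env) (fun k r => eval s (r :: k :: env)) (eval n env)
  end.

Lemma eq_prec b b' s s' n : b = b' -> s =2 s' -> prec b s n = prec b' s' n.
Proof. by move=> -> es; elim: n => //= n ->; rewrite es. Qed.

Fixpoint lift_term (k : nat) (t : term) : term :=
  match t with
  | Var i => Var (if i < k then i else i.+1)
  | Zero => Zero
  | Succ t1 => Succ (lift_term k t1)
  | Let t1 t2 => Let (lift_term k t1) (lift_term k.+1 t2)
  | Rec n b s => Rec (lift_term k n) (lift_term k b) (lift_term k.+2 s)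
  end.

(** The lifted term skips the variable at position [size a]. Writing [behead env] also covers an
    empty [env], as missing variables have the value 0. *)
Lemma eval_lift t a env :
  eval (lift_term (size a) t) (a ++ env) = eval t (a ++ behead env).
Proof.
elim: t a => //= [i|t IH|t IHt u IHu|n IHn b IHb s IHs] a.
- case: (ltnP i (size a)) => [lt|le]; rewrite !nth_cat ?lt //.
  by rewrite !ltnNge leqW // le /= subSn // nth_behead.
- by rewrite IH.
- by rewrite IHt (IHu (_ :: a)).
- rewrite IHn IHb; apply: eq_prec => // k r.
  by rewrite (IHs [:: r, k & a]).
Qed.

(** * Closure properties of representable functions *)

Definition rep (f : seq nat -> nat) : Prop :=
  exists t, forall env, eval t env = f env.

Lemma eq_rep f g : f =1 g -> rep f -> rep g.
Proof. by move=> e [t h]; exists t => env; rewrite h e. Qed.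

Lemma rep_nth i : rep (fun env => nth 0 env i).
Proof. by exists (Var i). Qed.

Lemma rep_weaken f : rep f -> rep (fun env => f (behead env)).
Proof. by case=> t h; exists (lift_term 0 t) => env; rewrite (eval_lift t [::]) h. Qed.

Lemma rep_succ f : rep f -> rep (fun env => (f env).+1).
Proof. by case=> t h; exists (Succ t) => env /=; rewrite h. Qed.

Lemma rep_const c : rep (fun=> c).
Proof. by elim: c => [|c /rep_succ]; first exists Zero. Qed.

Lemma rep_prec n b (s : nat -> nat -> seq nat -> nat) :
  rep n -> rep b ->
  rep (fun env => s (nth 0 env 1) (nth 0 env 0) (behead (behead env))) ->
  rep (fun env => prec (b env) (fun k r => s k r env) (n env)).
Proof.
move=> [tn hn] [tb hb] [ts hs]; exists (Rec tn tb ts) => env /=.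
by rewrite hn; apply: eq_prec => // k r; rewrite hs.
Qed.

(* [rep_weaken] accounts for the binders crossed since [H] was introduced. *)
Ltac rep_hyp :=
  match goal with H : rep _ |- _ =>
    solve [ exact H | exact (rep_weaken H) | exact (rep_weaken (rep_weaken H))
          | exact (rep_weaken (rep_weaken (rep_weaken H)))
          | exact (rep_weaken (rep_weaken (rep_weaken (rep_weaken H))))
          | exact (rep_weaken (rep_weaken (rep_weaken (rep_weaken (rep_weaken H))))) ]
  end.
Ltac rep_leaf :=
  solve [ rep_hyp | exact: rep_const
        | eexists (Var _) => ?; rewrite ?nth_behead; reflexivity ].

(** The condition, read as 0 or 1, serves as the number of iterations. *)
Lemma rep_if (c : seq nat -> bool) f g :
  rep c -> rep f -> rep g -> rep (fun env => if c env then f env else g env).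
Proof.
move=> hc hf hg.
apply: (@eq_rep (fun env => prec (g env) (fun _ _ => f env) (c env))).
  by move=> env; case: (c env).
by apply: rep_prec; rep_leaf.
Qed.

Lemma rep_negb (c : seq nat -> bool) : rep c -> rep (fun env => ~~ c env).
Proof.
move=> hc; apply: (@eq_rep (fun env => if c env then 0 else 1)).
  by move=> env; case: (c env).
by apply: rep_if; rep_leaf.
Qed.

Lemma rep_and (c d : seq nat -> bool) :
  rep c -> rep d -> rep (fun env => c env && d env).
Proof.
move=> hc hd; apply: (@eq_rep (fun env => if c env then d env : nat else 0)).
  by move=> env; case: (c env).
by apply: rep_if; rep_leaf.
Qed.

Lemma rep_add f g : rep f -> rep g -> rep (fun env => f env + g env).
Proof.
move=> hf hg.
apply: (@eq_rep (fun env => prec (f env) (fun _ r => r.+1) (g env))).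
  by move=> env; elim: (g env) => [|k /= ->]; rewrite ?addn0 ?addnS.
by apply: rep_prec; try apply: rep_succ; rep_leaf.
Qed.

Lemma rep_mul f g : rep f -> rep g -> rep (fun env => f env * g env).
Proof.
move=> hf hg.
apply: (@eq_rep (fun env => prec 0 (fun _ r => r + f env) (g env))).
  by move=> env; elim: (g env) => [|k /= ->]; rewrite ?muln0 ?mulnS 1?addnC.
by apply: rep_prec; try apply: rep_add; rep_leaf.
Qed.

Lemma rep_exp2 f : rep f -> rep (fun env => 2 ^ f env).
Proof.
move=> hf; apply: (@eq_rep (fun env => prec 1 (fun _ r => 2 * r) (f env))).
  by move=> env; elim: (f env) => [|k /= ->]; rewrite ?expnS.
by apply: rep_prec; try apply: rep_mul; rep_leaf.
Qed.

Lemma rep_pred f : rep f -> rep (fun env => (f env).-1).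
Proof.
move=> hf; apply: (@eq_rep (fun env => prec 0 (fun k _ => k) (f env))).
  by move=> env; case: (f env).
by apply: rep_prec; rep_leaf.
Qed.

Lemma rep_sub f g : rep f -> rep g -> rep (fun env => f env - g env).
Proof.
move=> hf hg.
apply: (@eq_rep (fun env => prec (f env) (fun _ r => r.-1) (g env))).
  by move=> env; elim: (g env) => [|k /= ->]; rewrite ?subn0 ?subnS.
by apply: rep_prec; try apply: rep_pred; rep_leaf.
Qed.

Lemma rep_leq f g : rep f -> rep g -> rep (fun env => f env <= g env).
Proof.
move=> hf hg.
apply: (@eq_rep (fun env => prec 1 (fun _ _ => 0) (f env - g env))).
  by move=> env; rewrite -subn_eq0; case: (_ - _).
by apply: rep_prec; try apply: rep_sub; rep_leaf.
Qed.

Lemma rep_ltn f g : rep f -> rep g -> rep (fun env => f env < g env).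
Proof. by move=> hf hg; apply: rep_leq => //; apply: rep_succ. Qed.

Lemma rep_eqn f g : rep f -> rep g -> rep (fun env => f env == g env).
Proof.
move=> hf hg.
apply: (@eq_rep (fun env => (f env <= g env) && (g env <= f env))).
  by move=> env; rewrite -eqn_leq.
by apply: rep_and; apply: rep_leq.
Qed.

(** After [k] rounds the accumulator is the result of the search below [k]; it is less than [k]
    exactly when the search has succeeded. *)
Lemma rep_find (P : nat -> seq nat -> bool) n :
  rep n -> rep (fun env => P (nth 0 env 0) (behead env)) ->
  rep (fun env => find (P^~ env) (iota 0 (n env))).
Proof.
move=> hn hP.
pose s k r env := if r < k then r else if P k env then k else k.+1.
apply: (@eq_rep (fun env => prec 0 (fun k r => s k r env) (n env))).
  move=> env; elim: (n env) => // k IH.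
  rewrite [LHS]/= IH -[in RHS]addn1 iotaD find_cat /s size_iota add0n has_find size_iota.
  by case: ifP => //= _; case: (P k env); rewrite ?addn0 ?addn1.
apply: rep_prec => //; first exact: rep_const.
apply: rep_if; first by apply: rep_ltn; rep_leaf.
  by rep_leaf.
apply: rep_if; try (by try apply: rep_succ; rep_leaf).
(* The term for [P] expects the index as variable 0. [Let] puts the counter in front, and two
   liftings skip the accumulator and the counter behind it. *)
case: hP => u hu.
exists (Let (Var 1) (lift_term 1 (lift_term 1 u))) => env /=.
by rewrite (eval_lift _ [:: _]) (eval_lift _ [:: _]) hu.
Qed.

Lemma rep_has (P : nat -> seq nat -> bool) n :
  rep n -> rep (fun env => P (nth 0 env 0) (behead env)) ->
  rep (fun env => has (P^~ env) (iota 0 (n env))).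
Proof.
move=> hn hP.
apply: (@eq_rep (fun env => find (P^~ env) (iota 0 (n env)) < n env)).
  by move=> env; rewrite has_find size_iota.
by apply: rep_ltn => //; apply: rep_find.
Qed.

Lemma rep_all (P : nat -> seq nat -> bool) n :
  rep n -> rep (fun env => P (nth 0 env 0) (behead env)) ->
  rep (fun env => all (P^~ env) (iota 0 (n env))).
Proof.
move=> hn hP.
apply: (@eq_rep (fun env => ~~ has (fun k => ~~ P k env) (iota 0 (n env)))).
  by move=> env; rewrite -(@all_predC _ (predC (P^~ env))); congr nat_of_bool;
     apply: eq_all => k /=; rewrite negbK.
by apply: rep_negb; apply: rep_has => //; apply: rep_negb.
Qed.

(** * Coding of pairs and lists *)

(** The code lies below the square of [a + b + 1], so [a + b] is its integer square root. The
    components are found by bounded search, which keeps them primitive recursive. *)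
Definition cpair a b := (a + b) * (a + b) + a.
Definition pfst n :=
  find (fun a => has (fun b => cpair a b == n) (iota 0 n.+1)) (iota 0 n.+1).
Definition psnd n := find (fun b => cpair (pfst n) b == n) (iota 0 n.+1).

Lemma pair_inj a b a' b' : cpair a b = cpair a' b' -> a = a' /\ b = b'.
Proof.
rewrite /cpair => e; suff : a + b = a' + b' by nia.
by case: (ltngtP (a + b) (a' + b')) => // h; nia.
Qed.

Lemma find_iota (p : pred nat) k n :
  k < n -> p k -> (forall i, i < k -> ~~ p i) -> find p (iota 0 n) = k.
Proof.
move=> kn pk pN; have h : has p (iota 0 n).
  by apply/hasP; exists k; rewrite ?mem_iota.
have fn : find p (iota 0 n) < n by move: h; rewrite has_find size_iota.
have := nth_find 0 h; rewrite nth_iota // add0n => pf.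
case: (ltngtP (find p (iota 0 n)) k) => //.
- by move=> /pN; rewrite pf.
- by move=> /(before_find 0); rewrite nth_iota // add0n pk.
Qed.

Lemma pfstE a b : pfst (cpair a b) = a.
Proof.
apply: find_iota; first by rewrite /cpair; nia.
  by apply/hasP; exists b; rewrite ?mem_iota // /cpair; nia.
move=> i ia; apply/hasPn => b' _; apply/eqP => /pair_inj; lia.
Qed.

Lemma psndE a b : psnd (cpair a b) = b.
Proof.
rewrite /psnd pfstE; apply: find_iota; first by rewrite /cpair; nia.
  by [].
by move=> i ib; apply/eqP => /pair_inj; lia.
Qed.

(** As [cpair 0 0] is 0, the number 0 acts as an endless list of zeros, and reading past the end
    gives 0. *)
Definition get l i := pfst (iter i psnd l).
Definition encode (s : seq nat) := foldr cpair 0 s.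

Lemma get0 i : get 0 i = 0.
Proof. by rewrite /get; elim: i => // i IH; rewrite iterSr; apply: IH. Qed.

Lemma get_pair0 a b : get (cpair a b) 0 = a.
Proof. exact: pfstE. Qed.

Lemma get_pairS a b i : get (cpair a b) i.+1 = get b i.
Proof. by rewrite /get iterSr psndE. Qed.

Lemma get_encode s i : get (encode s) i = nth 0 s i.
Proof.
elim: s i => [|x s IH] [|i] //=; rewrite ?get0 ?get_pair0 ?get_pairS //.
Qed.

Lemma rep_pair f g : rep f -> rep g -> rep (fun env => cpair (f env) (g env)).
Proof.
by move=> hf hg; apply: rep_add => //; apply: rep_mul; apply: rep_add.
Qed.

Lemma rep_pfst f : rep f -> rep (fun env => pfst (f env)).
Proof.
move=> hf; apply: (@rep_find (fun a env =>
  has (fun b => cpair a b == f env) (iota 0 (f env).+1)) (fun env => (f env).+1)).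
  exact: rep_succ.
apply: (@rep_has (fun b env => cpair (nth 0 env 0) b == f (behead env))
  (fun env => (f (behead env)).+1)); first by apply: rep_succ; rep_leaf.
by apply: rep_eqn; try apply: rep_pair; rep_leaf.
Qed.

Lemma rep_psnd f : rep f -> rep (fun env => psnd (f env)).
Proof.
move=> hf; apply: (@rep_find (fun b env => cpair (pfst (f env)) b == f env)
  (fun env => (f env).+1)); first exact: rep_succ.
apply: rep_eqn; last by rep_leaf.
by apply: rep_pair; try apply: rep_pfst; rep_leaf.
Qed.

Lemma rep_get f g : rep f -> rep g -> rep (fun env => get (f env) (g env)).
Proof.
move=> hf hg; apply: rep_pfst.
apply: (@eq_rep (fun env => prec (f env) (fun _ r => psnd r) (g env))).
  by move=> env; elim: (g env) => //= k ->.
by apply: rep_prec; try apply: rep_psnd; rep_leaf.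
Qed.

(** * Counter programs *)

Definition mem := nat -> nat.
Definition upd (s : mem) (r x : nat) : mem := fun r' => if r' == r then x else s r'.

Inductive cmd :=
  | Inc of nat | Dec of nat | Seq of cmd & cmd | While of nat & cmd
  | Ifz of nat & cmd.

Inductive exec : cmd -> mem -> nat -> mem -> Prop :=
  | ExecInc r s : exec (Inc r) s 1 (upd s r (s r).+1)
  | ExecDec r s : exec (Dec r) s 1 (upd s r (s r).-1)
  | ExecSeq a b s T1 s1 T2 s2 :
      exec a s T1 s1 -> exec b s1 T2 s2 -> exec (Seq a b) s (T1 + T2) s2
  | ExecWhile0 r c s : s r = 0 -> exec (While r c) s 1 s
  | ExecWhileS r c s T1 s1 T2 s2 :
      s r != 0 -> exec c s T1 s1 -> exec (While r c) s1 T2 s2 ->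
      exec (While r c) s (T1 + T2).+1 s2
  | ExecIfz0 r c s T s1 : s r = 0 -> exec c s T s1 -> exec (Ifz r c) s T.+1 s1
  | ExecIfzS r c s : s r != 0 -> exec (Ifz r c) s 1 s.

Lemma execE c s T s' T1 s1 :
  exec c s T s' -> T = T1 -> s' =1 s1 -> exec c s T1 s1.
Proof. by move=> h <- /funext <-. Qed.

Lemma exec_seq a b s T1 s1 T2 s2 T :
  exec a s T1 s1 -> exec b s1 T2 s2 -> T = T1 + T2 -> exec (Seq a b) s T s2.
Proof. by move=> ha hb ->; apply: ExecSeq ha hb. Qed.

Lemma exec_incE r s T s' :
  exec (Inc r) s T s' -> T = 1 /\ s' = upd s r (s r).+1.
Proof. by move=> h; inversion h. Qed.

Lemma exec_seqE a b s T s' : exec (Seq a b) s T s' ->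
  exists T1 s1 T2, [/\ exec a s T1 s1, exec b s1 T2 s' & T = T1 + T2].
Proof. by move=> h; inversion h; subst; exists T1, s1, T2. Qed.

Fixpoint mentions (k : nat) (c : cmd) : bool :=
  match c with
  | Inc r | Dec r => r == k
  | Seq a b => mentions k a || mentions k b
  | While r a | Ifz r a => (r == k) || mentions k a
  end.

(** Every step is paired with one increment of [k]. In a loop the leading [Inc k] pays for the first
    test, and the one after the body for the next test. *)
Fixpoint tick (k : nat) (c : cmd) : cmd :=
  match c with
  | Inc r => Seq (Inc k) (Inc r)
  | Dec r => Seq (Inc k) (Dec r)
  | Seq a b => Seq (tick k a) (tick k b)
  | While r a => Seq (Inc k) (While r (Seq (tick k a) (Inc k)))
  | Ifz r a => Seq (Inc k) (Ifz r (tick k a))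
  end.

Lemma exec_tick k c s T s' :
  exec c s T s' -> ~~ mentions k c -> forall x,
  exec (tick k c) (upd s k x) (2 * T) (upd s' k (x + T)).
Proof.
have updk (t : mem) x y : upd (upd t k x) k y = upd t k y.
  by apply/funext => i; rewrite /upd; case: eqP.
have at_k (t : mem) x : upd t k x k = x by rewrite /upd eqxx.
have out (t : mem) x r : r != k -> upd t k x r = t r.
  by rewrite /upd => /negbTE ->.
have tickE (t : mem) x :
    exec (Inc k) (upd t k x) 1 (upd t k (x + 1)).
  apply: execE (ExecInc _ _) _ _ => // i.
  by rewrite updk at_k addn1.
elim=> {c s T s'} /=.
- move=> r s rk x; apply: execE (ExecSeq (tickE s x) (ExecInc _ _)) _ _ => // i.
  by rewrite out // /upd; case: (eqVneq i r) => [->|//]; rewrite (negbTE rk).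
- move=> r s rk x; apply: execE (ExecSeq (tickE s x) (ExecDec _ _)) _ _ => // i.
  by rewrite out // /upd; case: (eqVneq i r) => [->|//]; rewrite (negbTE rk).
- move=> a b s T1 s1 T2 s2 _ IHa _ IHb; rewrite negb_or => /andP[ha hb] x.
  rewrite addnA; apply: exec_seq (IHa ha x) (IHb hb _) _; lia.
- move=> r c s r0; rewrite negb_or => /andP[rk _] x.
  apply: exec_seq (tickE s x) (ExecWhile0 _ _) _ => //.
  by rewrite out.
- move=> r c s T1 s1 T2 s2 r0 _ IHc _ IHw hr x.
  have := hr; rewrite negb_or => /andP[rk hc].
  (* The induction hypothesis for the rest of the loop begins with an [Inc k]; it is split off and
     becomes the end of the current iteration. *)
  have [Ta [sm [Tb []]]] := exec_seqE (IHw hr (x + 1 + T1)).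
  move=> /exec_incE[-> ->]; rewrite at_k updk -addn1 => hw eT.
  apply: (exec_seq (tickE s x)).
    rewrite (_ : x + (T1 + T2).+1 = x + 1 + T1 + T2); last by lia.
    apply: (ExecWhileS _ _ hw); first by rewrite out.
    exact: exec_seq (IHc hc _) (tickE _ _) erefl.
  lia.
- move=> r c s T s1 r0 _ IH; rewrite negb_or => /andP[rk hc] x.
  rewrite (_ : x + T.+1 = x + 1 + T); last by lia.
  apply: exec_seq (tickE s x) (ExecIfz0 _ (IH hc _)) _; last by lia.
  by rewrite out.
- move=> r c s r0; rewrite negb_or => /andP[rk _] x.
  by apply: exec_seq (tickE s x) (ExecIfzS _ _) _; rewrite ?out.
Qed.

Definition clear r := While r (Dec r).
Definition move_reg r s := While r (Seq (Dec r) (Inc s)).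
Definition copy r s t :=
  Seq (While r (Seq (Dec r) (Seq (Inc s) (Inc t)))) (move_reg t r).

Ltac upd_simpl := rewrite /upd; repeat (case: eqP => ?; subst); try lia.

Lemma exec_clear r s : exec (clear r) s (2 * s r + 1) (upd s r 0).
Proof.
move e: (s r) => n; elim: n s e => [|n IH] s e.
  apply: execE (ExecWhile0 _ e) _ _ => // i; upd_simpl.
apply: execE (ExecWhileS _ (ExecDec _ _) (IH _ _)) _ _; rewrite ?e //.
- by rewrite /upd eqxx.
- lia.
- by move=> i; upd_simpl.
Qed.

Lemma exec_move r t s : r != t ->
  exec (move_reg r t) s (3 * s r + 1) (upd (upd s r 0) t (s t + s r)).
Proof.
move=> /eqP rt; move e: (s r) => n; elim: n s e => [|n IH] s e.
  apply: execE (ExecWhile0 _ e) _ _ => // i; upd_simpl.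
apply: execE (ExecWhileS _ (ExecSeq (ExecDec _ _) (ExecInc _ _)) (IH _ _)) _ _;
  rewrite ?e //.
- upd_simpl.
- lia.
- move=> i; upd_simpl.
Qed.

Lemma exec_copy r t u s : r != t -> r != u -> t != u -> s u = 0 ->
  exec (copy r t u) s (7 * s r + 2) (upd s t (s t + s r)).
Proof.
move=> rt ru tu u0.
have h : exec (While r (Seq (Dec r) (Seq (Inc t) (Inc u)))) s (4 * s r + 1)
   (upd (upd (upd s r 0) t (s t + s r)) u (s u + s r)).
  move: rt ru tu {u0} => /eqP rt /eqP ru /eqP tu.
  move e: (s r) => n; elim: n s e => [|n IH] s e.
    apply: execE (ExecWhile0 _ e) _ _ => // i; upd_simpl.
  apply: execE (ExecWhileS _ (ExecSeq (ExecDec _ _)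
    (ExecSeq (ExecInc _ _) (ExecInc _ _))) (IH _ _)) _ _; rewrite ?e //.
  - upd_simpl.
  - lia.
  - move=> i; upd_simpl.
apply: execE (ExecSeq h (exec_move _ _)) _ _; first by rewrite eq_sym.
- rewrite {1}/upd eqxx; lia.
- move: rt ru tu => /eqP rt /eqP ru /eqP tu i; upd_simpl.
Qed.

(** * Compilation of terms *)

(** Variable [i] lives in register [nth d.+2 rho i]. The registers from [d] on are 0 at the start,
    and at the end all of them but [d], which holds the result. So [Dec d] does nothing and the
    default [d.+2] reads 0. [Rec] keeps the remaining rounds in [d], the counter in [d.+1] and the
    accumulator in [d.+2]. *)
Fixpoint compile (rho : seq nat) (d : nat) (t : term) : cmd :=
  match t with
  | Var i => copy (nth d.+2 rho i) d d.+1
  | Zero => Dec d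
  | Succ t1 => Seq (compile rho d t1) (Inc d)
  | Let t1 t2 =>
      Seq (compile rho d t1) (Seq (compile (d :: rho) d.+1 t2)
        (Seq (clear d) (move_reg d.+1 d)))
  | Rec n b s =>
      Seq (compile rho d n) (Seq (compile rho d.+2 b)
       (Seq (While d (Seq (Dec d) (Seq (compile [:: d.+2, d.+1 & rho] d.+3 s)
                (Seq (clear d.+2) (Seq (move_reg d.+3 d.+2) (Inc d.+1))))))
         (Seq (clear d.+1) (move_reg d.+2 d))))
  end.

(** The exact running time depends only on the values of the variables, so the clock can later be
    described without reference to registers. *)
Fixpoint cost (t : term) (env : seq nat) : nat :=
  match t with
  | Var i => 7 * nth 0 env i + 2
  | Zero => 1
  | Succ t1 => cost t1 env + 1
  | Let t1 t2 =>
      let v := eval t1 env in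
      cost t1 env + (cost t2 (v :: env) + (2 * v + 1 +
        (3 * eval t2 (v :: env) + 1)))
  | Rec n b s =>
      let f := fun k r => eval s (r :: k :: env) in
      let R := fun k => prec (eval b env) f k in
      cost n env + (cost b env + (prec 0 (fun k c => c + (1 + (1 +
         (cost s (R k :: k :: env) + (2 * R k + 1 + (3 * R k.+1 + 1 + 1))))))
           (eval n env) + 1
      + (2 * eval n env + 1 + (3 * R (eval n env) + 1))))
  end.

Lemma map_upd (s : mem) rho d x :
  all (fun r => r < d) rho -> map (upd s d x) rho = map s rho.
Proof.
move=> /allP h; apply/eq_in_map => r /h; rewrite /upd.
by case: eqP => // ->; rewrite ltnn.
Qed.

Lemma all_ltW rho d e :
  d <= e -> all (fun r => r < d) rho -> all (fun r => r < e) rho.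
Proof. by move=> de; apply: sub_all => r /leq_trans; apply. Qed.

Lemma exec_compile t rho d s :
  all (fun r => r < d) rho -> (forall r, d <= r -> s r = 0) ->
  exec (compile rho d t) s (cost t (map s rho)) (upd s d (eval t (map s rho))).
Proof.
elim: t rho d s => /= [i||t IH|t IHt u IHu|n IHn b IHb f IHf] rho d s hr hs.
- have hn : s (nth d.+2 rho i) = nth 0 (map s rho) i.
    case: (ltnP i (size rho)) => hi; first by rewrite (nth_map d.+2).
    by rewrite !nth_default ?size_map // hs //; lia.
  have ne : (nth d.+2 rho i < d) || (nth d.+2 rho i == d.+2).
    case: (ltnP i (size rho)) => hi; last by rewrite nth_default ?eqxx ?orbT.
    by rewrite (allP hr) // mem_nth.
  apply: execE (exec_copy _ _ _ _) _ _; rewrite ?hn //; try lia.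
  + by rewrite hs.
  + by move=> j; rewrite hs //; lia.
- apply: execE (ExecDec _ _) _ _ => // i; rewrite hs //.
- apply: execE (ExecSeq (IH _ _ _ hr hs) (ExecInc _ _)) _ _ => // i; upd_simpl.
- set v := eval t _.
  have hr1 : all (fun r => r < d.+1) (d :: rho) by rewrite /= leqnn (all_ltW _ hr).
  have hs1 r : d.+1 <= r -> upd s d v r = 0 by move=> ?; upd_simpl; apply: hs; lia.
  have vd : upd s d v d = v by rewrite /upd eqxx.
  have := IHu _ _ _ hr1 hs1; rewrite /= map_upd // vd => h2.
  set w := eval u _ in h2 *.
  have h3 := exec_clear d (upd (upd s d v) d.+1 w).
  have h4 := @exec_move d.+1 d (upd (upd (upd s d v) d.+1 w) d 0) _.
  apply: execE (ExecSeq (IHt _ _ _ hr hs) (ExecSeq h2 (ExecSeq h3 (h4 _)))) _ _.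
  + by rewrite neq_ltn ltnSn orbT.
  + rewrite -/v -/w; congr (_ + (_ + (_ + _))); upd_simpl.
  + have := hs d.+1; have := hs d => e0 e1 i; rewrite -/v; upd_simpl.
- set env := map s rho; set N := eval n env; set B := eval b env.
  set g := fun k r => eval f (r :: k :: env).
  (* The memory at the loop test: [k] rounds left, [m] rounds done, accumulator [r]. *)
  pose st k m r := upd (upd (upd s d k) d.+1 m) d.+2 r.
  have hrS k : all (fun r => r < d + k) rho by apply: all_ltW hr; lia.
  have h2 : exec (compile rho d.+2 b) (upd s d N) (cost b env) (st N 0 B).
    have hs1 r : d.+2 <= r -> upd s d N r = 0.
      by move=> ?; upd_simpl; apply: hs; lia.
    have := IHb rho d.+2 _ _ hs1; rewrite map_upd // -/env -/B -addn2 => /(_ (hrS 2)).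
    move=> h; apply: execE h _ _ => // i; rewrite /st; upd_simpl.
    by rewrite hs //; lia.
  set C := fun k c => c + _.
  (* The loop is started at an arbitrary round [m] for the induction. Its time is a difference of
     accumulated costs, which does not truncate by [mono] below. *)
  have h3 k m : exec (While d (Seq (Dec d)
     (Seq (compile [:: d.+2, d.+1 & rho] d.+3 f) (Seq (clear d.+2)
       (Seq (move_reg d.+3 d.+2) (Inc d.+1)))))) (st k m (prec B g m))
     (prec 0 C (k + m) - prec 0 C m + 1) (st 0 (k + m) (prec B g (k + m))).
    elim: k m => [|k IHk] m.
      apply: execE (ExecWhile0 _ _) _ _; rewrite ?add0n ?subnn //.
      by rewrite /st; upd_simpl.
    set r := prec B g m.
    have hs1 x : d.+3 <= x -> st k m r x = 0.
      by move=> ?; rewrite /st; upd_simpl; apply: hs; lia.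
    have hr1 : all (fun x => x < d.+3) [:: d.+2, d.+1 & rho].
      by rewrite /= leqnn leqW //= -(addn3 d) hrS.
    have e1 : map (st k m r) [:: d.+2, d.+1 & rho] = [:: r, m & env].
      rewrite /= {1 2}/st; congr [:: _, _ & _]; try by upd_simpl.
      apply/eq_in_map => x /(allP hr) ?; rewrite /st; upd_simpl.
    have := IHf _ _ _ hr1 hs1; rewrite e1 => h4.
    have hC : prec 0 C m.+1 = C m (prec 0 C m) by [].
    have mono a c : prec 0 C a <= prec 0 C (c + a).
      by elim: c => //= c IHc; apply: leq_trans IHc _; apply: leq_addr.
    have e2 : upd (st k.+1 m r) d (st k.+1 m r d).-1 = st k m r.
      by apply/funext => i; rewrite /st; upd_simpl.
    rewrite -e2 in h4; rewrite -/(g m r) in h4.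
    set r' := g m r in h4 *.
    set s1 := upd _ d.+3 r' in h4.
    have h5 := exec_clear d.+2 s1.
    have h6 := @exec_move d.+3 d.+2 (upd s1 d.+2 0) _.
    have e3 : s1 d.+2 = r by rewrite /s1 /st; upd_simpl.
    have e4 : upd s1 d.+2 0 d.+3 = r' by rewrite /s1; upd_simpl.
    rewrite e3 in h5; rewrite e4 in h6.
    set s2 := upd _ d.+2 (_ + r') in h6.
    have e5 : upd s2 d.+1 (s2 d.+1).+1 = st k m.+1 r'.
      apply/funext => i; rewrite /s2 /s1 e2 /st; have := hs d.+3; upd_simpl.
    have h7 := IHk m.+1; rewrite -[prec B g m.+1]/r' -e5 in h7.
    apply: execE (ExecWhileS _ (ExecSeq (ExecDec _ _) (ExecSeq h4 (ExecSeq h5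
      (ExecSeq (h6 _) (ExecInc _ _))))) h7) _ _ => //.
    + have -> : st k.+1 m r d = k.+1 by rewrite /st; upd_simpl.
      by [].
    + by rewrite neq_ltn ltnSn orbT.
    + have := mono m.+1 k; rewrite -addSnnS hC /C -/r -/(g m r) -/r'.
      lia.
    + by rewrite -addSnnS.
  have hn := IHn _ _ _ hr hs; rewrite -/env -/N in hn.
  have h4 := h3 N 0; rewrite addn0 in h4.
  set R := prec B g N in h4 *.
  have h5 := exec_clear d.+1 (st 0 N R).
  have h6 := @exec_move d.+2 d (upd (st 0 N R) d.+1 0) _.
  have e1 : st 0 N R d.+1 = N by rewrite /st; upd_simpl.
  have e2 : upd (st 0 N R) d.+1 0 d.+2 = R by rewrite /st; upd_simpl.
  rewrite e1 in h5; rewrite e2 in h6.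
  apply: execE (ExecSeq hn (ExecSeq h2 (ExecSeq h4 (ExecSeq h5 (h6 _))))) _ _.
  + by rewrite neq_ltn leqW // orbT.
  + rewrite subn0; lia.
  + move=> i; have := hs d.+1; have := hs d.+2; rewrite /st; upd_simpl.
Qed.

Lemma mentions_compile k t rho d :
  k < d -> k \notin rho -> ~~ mentions k (compile rho d t).
Proof.
elim: t rho d => /= [i||t IH|t IHt u IHu|n IHn b IHb f IHf] rho d kd kr.
- have : nth d.+2 rho i != k.
    case: (ltnP i (size rho)) => hi; last by rewrite nth_default; lia.
    by apply: contraNneq kr => <-; rewrite mem_nth.
  lia.
- lia.
- by rewrite negb_or IH //; lia.
- have kr1 : k \notin d :: rho by rewrite inE negb_or kr andbT; lia.
  by rewrite !negb_or IHt ?IHu //=; lia.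
- have kr2 : k \notin [:: d.+2, d.+1 & rho].
    by rewrite !inE !negb_or kr andbT; lia.
  by rewrite !negb_or IHn ?IHb ?IHf //=; lia.
Qed.

(** The value is computed in scratch before [x] is cleared, so [x] may itself be one of the
    variables. *)
Definition assign x rho d t := Seq (compile rho d t) (Seq (clear x) (move_reg d x)).

Definition assign_cost old t env := cost t env + (2 * old + 1 + (3 * eval t env + 1)).

Lemma exec_assign x rho d t s :
  all (fun r => r < d) rho -> (forall r, d <= r -> s r = 0) -> x < d ->
  exec (assign x rho d t) s (assign_cost (s x) t (map s rho))
    (upd s x (eval t (map s rho))).
Proof.
move=> hr hs xd; have h1 := exec_compile t hr hs.
set v := eval _ _ in h1 *.
have h2 := exec_clear x (upd s d v).
have h3 := @exec_move d x (upd (upd s d v) x 0) _.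
apply: execE (ExecSeq h1 (ExecSeq h2 (h3 _))) _ _; first by lia.
- by rewrite /assign_cost -/v; congr (_ + (_ + _)); upd_simpl.
- move=> i; have := hs d; upd_simpl.
Qed.

Lemma mentions_assign k x rho d t :
  k < d -> k \notin rho -> k != x -> ~~ mentions k (assign x rho d t).
Proof.
move=> kd kr kx /=; rewrite negb_or mentions_compile //=; lia.
Qed.

Lemma exec_tick_assign k x rho d t s :
  all (fun r => r < d) rho -> (forall r, d <= r -> s r = 0) ->
  x < d -> k < d -> k \notin rho -> k != x ->
  exec (tick k (assign x rho d t)) s (2 * assign_cost (s x) t (map s rho))
   (upd (upd s x (eval t (map s rho))) k
      (s k + assign_cost (s x) t (map s rho))).
Proof.
move=> hr hs xd kd kr kx.
have := exec_tick (exec_assign t hr hs xd) (mentions_assign _ kd kr kx) (s k).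
have -> // : upd s k (s k) = s by apply/funext => i; upd_simpl.
Qed.

(** * Control flow of counter programs *)

(* Control points of a program: for [While] and [Ifz], [None] is the test. *)
Fixpoint point (c : cmd) : finType :=
  match c with
  | Inc _ | Dec _ => unit
  | Seq a b => (point a + point b)%type
  | While _ a | Ifz _ a => option (point a)
  end.

Fixpoint entry (c : cmd) : point c :=
  match c with
  | Inc _ | Dec _ => tt
  | Seq a b => inl (entry a)
  | While _ _ | Ifz _ _ => None
  end.

(* The register to be changed, and whether it is incremented. *)
Definition action := option (bool * nat).

(* [nz] tells which registers are nonzero; the resulting control point is [None]
   at the end of the program. *)
Fixpoint next (c : cmd) (nz : nat -> bool) : point c -> action * option (point c) :=
  match c with
  | Inc r => fun=> (Some (true, r), None)
  | Dec r => fun=> (Some (false, r), None)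
  | Seq a b => fun p =>
      match p with
      | inl p1 => let: (x, q) := next nz p1 in
          (x, Some (if q is Some p2 then inl p2 else inr (entry b)))
      | inr p1 => let: (x, q) := next nz p1 in (x, omap inr q)
      end
  | While r a => fun p =>
      match p with
      | None => (None, if nz r then Some (Some (entry a)) else None)
      | Some p1 => let: (x, q) := next nz p1 in (x, Some q)
      end
  | Ifz r a => fun p =>
      match p with
      | None => (None, if nz r then None else Some (Some (entry a)))
      | Some p1 => let: (x, q) := next nz p1 in (x, omap some q)
      end
  end.

Definition apply_action (x : action) (s : mem) : mem :=
  match x with
  | None => s
  | Some (true, r) => upd s r (s r).+1
  | Some (false, r) => upd s r (s r).-1
  end.

Definition nonzero (s : mem) r := s r != 0.

Inductive goes (c : cmd) :
    option (point c) -> mem -> nat -> option (point c) -> mem -> Prop :=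
  | Goes0 q s : goes q s 0 q s
  | GoesS p s n q s' :
      goes (next (nonzero s) p).2 (apply_action (next (nonzero s) p).1 s) n q s' ->
      goes (Some p) s n.+1 q s'.

Lemma goes_someE c (p : point c) s n q s' : goes (Some p) s n.+1 q s' ->
  goes (next (nonzero s) p).2 (apply_action (next (nonzero s) p).1 s) n q s'.
Proof. by move=> h; inversion h. Qed.

Lemma goes_trans c (q : option (point c)) s n q1 s1 m q2 s2 :
  goes q s n q1 s1 -> goes q1 s1 m q2 s2 -> goes q s (n + m) q2 s2.
Proof.
elim=> {q s n q1 s1} // p s n q1 s1 _ IH h.
by rewrite addSn; apply: GoesS; apply: IH.
Qed.

Lemma goes_det c (q : option (point c)) s n q1 s1 m q2 s2 :
  goes q s n q1 s1 -> goes q s m q2 s2 -> n <= m -> goes q1 s1 (m - n) q2 s2.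
Proof.
move=> h; elim: h m => {q s n q1 s1} [q s|p s n q1 s1 _ IH] m.
  by rewrite subn0.
move=> h; inversion h; subst => //.
by rewrite ltnS subSS; apply: IH.
Qed.

Lemma goes_end c s n q (s' : mem) : @goes c None s n q s' -> n = 0.
Proof. by move=> h; inversion h. Qed.

Lemma goes_seql a b q s n q' s' : @goes a q s n q' s' ->
  @goes (Seq a b) (Some (if q is Some p then inl p else inr (entry b))) s n
    (Some (if q' is Some p then inl p else inr (entry b))) s'.
Proof.
elim=> {q s n q' s'} [q s|p s n q s' _ IH]; first exact: Goes0.
by apply: GoesS => /=; case: (next _ p) IH.
Qed.

Lemma goes_seqr a b q s n q' s' : @goes b q s n q' s' ->
  @goes (Seq a b) (omap inr q) s n (omap inr q') s'.
Proof.
elim=> {q s n q' s'} [q s|p s n q s' _ IH]; first exact: Goes0.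
by apply: GoesS => /=; case: (next _ p) IH.
Qed.

Lemma goes_while r a q s n q' s' : @goes a q s n q' s' ->
  @goes (While r a) (Some q) s n (Some q') s'.
Proof.
elim=> {q s n q' s'} [q s|p s n q s' _ IH]; first exact: Goes0.
by apply: GoesS => /=; case: (next _ p) IH.
Qed.

Lemma goes_ifz r a q s n q' s' : @goes a q s n q' s' ->
  @goes (Ifz r a) (omap some q) s n (omap some q') s'.
Proof.
elim=> {q s n q' s'} [q s|p s n q s' _ IH]; first exact: Goes0.
by apply: GoesS => /=; case: (next _ p) IH.
Qed.

Lemma exec_goes c s T s' :
  exec c s T s' -> @goes c (Some (entry c)) s T None s'.
Proof.
elim=> {c s T s'} /=.
- by move=> r s; apply: GoesS; apply: Goes0.
- by move=> r s; apply: GoesS; apply: Goes0.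
- move=> a b s T1 s1 T2 s2 _ h1 _ h2.
  exact: goes_trans (goes_seql b h1) (goes_seqr a h2).
- move=> r c s r0; apply: GoesS => /=; rewrite /nonzero r0 eqxx; exact: Goes0.
- move=> r c s T1 s1 T2 s2 r0 _ h1 _ h2; apply: GoesS => /=; rewrite /nonzero r0.
  exact: goes_trans (goes_while r h1) h2.
- move=> r c s T s1 r0 _ h; apply: GoesS => /=; rewrite /nonzero r0 eqxx /=.
  by have := goes_ifz r h.
- move=> r c s r0; apply: GoesS => /=; rewrite /nonzero r0; exact: Goes0.
Qed.

Lemma goes_iteration r a s T s' : s r != 0 -> exec a s T s' ->
  @goes (While r a) (Some None) s T.+1 (Some None) s'.
Proof.
move=> r0 /exec_goes h; apply: GoesS => /=; rewrite /nonzero r0.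
by have := goes_while r h.
Qed.

Fixpoint max_reg (c : cmd) : nat :=
  match c with
  | Inc r | Dec r => r
  | Seq a b => maxn (max_reg a) (max_reg b)
  | While r a | Ifz r a => maxn r (max_reg a)
  end.

(** Register 0 will be the unread part of the input, which a head moving right can only shorten; the
    simulation is for programs that never increment it. *)
Fixpoint increments (k : nat) (c : cmd) : bool :=
  match c with
  | Inc r => r == k
  | Dec r => false
  | Seq a b => increments k a || increments k b
  | While r a | Ifz r a => increments k a
  end.

Lemma increments_mentions k c : ~~ mentions k c -> ~~ increments k c.
Proof.
elim: c => //= [a IHa b IHb|r a IH|r a IH].
- by rewrite !negb_or => /andP[/IHa-> /IHb->].
- by rewrite negb_or => /andP[_ /IH].
- by rewrite negb_or => /andP[_ /IH].
Qed.

Lemma increments_tick k j c : k != j -> increments k (tick j c) = increments k c.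
Proof.
move=> kj; have h : (j == k) = false by rewrite eq_sym; apply: negbTE.
by elim: c => //= [r|r|a -> b ->|r a ->|r a ->]; rewrite ?h ?orbF.
Qed.

Lemma next_reg c nz (p : point c) b r q : next nz p = (Some (b, r), q) ->
  (r <= max_reg c) && (b ==> increments r c).
Proof.
elim: c p q => /= [r'|r'|a IHa c IHc|r' a IH|r' a IH] p q.
- by case=> <- <- _; rewrite leqnn eqxx implybT.
- by case=> <- <- _; rewrite leqnn.
- case: p => p; case E: (next nz p) => [x q1] [ex _]; subst x.
    by have /andP[h1 h2] := IHa _ _ E; rewrite leq_max h1; case: (b) h2 => //= ->.
  by have /andP[h1 h2] := IHc _ _ E;
     rewrite leq_max h1 orbT; case: (b) h2 => //= ->; rewrite orbT.
- case: p => // p; case E: (next nz p) => [x q1] [ex _]; subst x.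
  by have /andP[h1 h2] := IH _ _ E; rewrite leq_max h1 orbT.
- case: p => // p; case E: (next nz p) => [x q1] [ex _]; subst x.
  by have /andP[h1 h2] := IH _ _ E; rewrite leq_max h1 orbT.
Qed.

Lemma eq_next c nz nz' (p : point c) :
  (forall r, r <= max_reg c -> nz r = nz' r) -> next nz p = next nz' p.
Proof.
elim: c p => //= [a IHa b IHb|r a IH|r a IH] p e.
- have ha r : r <= max_reg a -> nz r = nz' r.
    by move=> hr; apply: e; rewrite leq_max hr.
  have hb r : r <= max_reg b -> nz r = nz' r.
    by move=> hr; apply: e; rewrite leq_max hr orbT.
  by case: p => p; rewrite ?(IHa _ ha) ?(IHb _ hb).
- have ha r' : r' <= max_reg a -> nz r' = nz' r'.
    by move=> hr; apply: e; rewrite leq_max hr orbT.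
  by case: p => [p|]; rewrite ?(IH _ ha) ?e // leq_maxl.
- have ha r' : r' <= max_reg a -> nz r' = nz' r'.
    by move=> hr; apply: e; rewrite leq_max hr orbT.
  by case: p => [p|]; rewrite ?(IH _ ha) ?e // leq_maxl.
Qed.

(** * The enumerating program *)

Definition f_state x := get x 0.
Definition f_next x := get x 1.
Definition f_read x i := get (get x 2) i.
Definition f_write x i := get (get x 3) i.
Definition f_dir x i := get (get x 4) i.

(* Directions are coded by 0, 1, 2, so that the head of tape [i] is at
   cell [pos l i u - u] after [u] steps of the trace [l]. *)
Definition pos l i u := prec 0 (fun k r => r + f_dir (get l k) i) u.

(** The head is at cell [p - u] and the input consists of [y] letters [true]. Code 1 is the letter
    [true], code 0 the blank. *)
Definition initial_sym y i p u : nat := (i == 0) && ((u <= p) && (p < u + y)).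

(* The symbol under the head of tape [i] after [u] steps is the last one written
   at that position, if any. *)
Definition sym l y i u :=
  prec (initial_sym y i (pos l i u) u)
    (fun k r => if pos l i u + k == pos l i k + u then f_write (get l k) i else r) u.

(** The machine code [e] lists the number of tapes, the number of possible situations, and their
    codes. *)
Definition valid_step e y l n u : bool :=
  has (fun k => get (get e 2) k == get l u) (iota 0 (get e 1))
  && (all (fun i => f_read (get l u) i == sym l y i u) (iota 0 (get e 0))
  && (if u.+1 < n then f_next (get l u) == f_state (get l u.+1) else true)).

(** [c] codes the length and the entries of a rejecting computation: the start state has code 1, and
    next state 0 in the last entry means that no command applies. *)
Definition valid e y c : bool :=
  let n := pfst c in let l := psnd c in
  (0 < n) && ((f_state (get l 0) == 1)
  && (all (valid_step e y l n) (iota 0 n) && (f_next (get l n.-1) == 0))).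

Definition acts e h N : bool :=
  all (fun i => pfst (get h i) != 2 * e + 1) (iota 0 N)
  && has (fun i => (2 * e + 1 < pfst (get h i))
        && has (valid e (psnd (get h i))) (iota 0 N)) (iota 0 N).

(** Odd values serve the diagonalization, least machine first; the even default is new because [N]
    grows at every stage. *)
Definition pick h N :=
  if find (fun e => acts e h N) (iota 0 N) < N
  then 2 * find (fun e => acts e h N) (iota 0 N) + 1 else 2 * N.

(** * Primitive recursiveness of the choice of values *)

Lemma rep_ifb (c f g : seq nat -> bool) :
  rep c -> rep f -> rep g -> rep (fun env => if c env then f env else g env).
Proof.
move=> hc hf hg; apply: (@eq_rep (fun env => if c env then f env : nat else g env)).
  by move=> env; case: (c env).
exact: rep_if.
Qed.

Ltac rep_step :=
  cbv beta; lazymatch goal with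
  | |- rep (fun env => nat_of_bool (@?a env && @?b env)) => apply: (@rep_and a b)
  | |- rep (fun env => nat_of_bool (@?a env <= @?b env)) => apply: (@rep_leq a b)
  | |- rep (fun env => nat_of_bool (@?a env == @?b env)) => apply: (@rep_eqn a b)
  | |- rep (fun env => nat_of_bool (~~ @?a env)) => apply: (@rep_negb a)
  | |- rep (fun env => @?a env + @?b env) => apply: (@rep_add a b)
  | |- rep (fun env => @?a env * @?b env) => apply: (@rep_mul a b)
  | |- rep (fun env => (@?a env).-1) => apply: (@rep_pred a)
  | |- rep (fun env => pfst (@?a env)) => apply: (@rep_pfst a)
  | |- rep (fun env => psnd (@?a env)) => apply: (@rep_psnd a)
  | |- rep (fun env => get (@?a env) (@?b env)) => apply: (@rep_get a b)
  | |- rep (fun env => cpair (@?a env) (@?b env)) => apply: (@rep_pair a b)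
  | |- rep (fun env => nth 0 (@?a env) ?n) =>
      eexists (Var _) => ?; rewrite ?nth_behead; reflexivity
  | |- rep (fun env => (@?a env).+1) => first [exact: rep_const | apply: (@rep_succ a)]
  | |- rep (fun env => f_state (@?a env)) => rewrite /f_state
  | |- rep (fun env => f_next (@?a env)) => rewrite /f_next
  | |- rep (fun env => f_read (@?a env) (@?b env)) => rewrite /f_read
  | |- rep (fun env => f_write (@?a env) (@?b env)) => rewrite /f_write
  | |- rep (fun env => f_dir (@?a env) (@?b env)) => rewrite /f_dir
  | |- rep (fun=> ?c) => exact: rep_const
  | |- _ => rep_hyp
  end.
Ltac rep_auto := repeat rep_step.

Lemma rep_pos l i u : rep l -> rep i -> rep u ->
  rep (fun env => pos (l env) (i env) (u env)).
Proof.
move=> hl hi hu.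
apply: (@rep_prec u (fun=> 0)
  (fun k r env => r + f_dir (get (l env) k) (i env))); rep_auto.
Qed.

Lemma rep_sym l y i u : rep l -> rep y -> rep i -> rep u ->
  rep (fun env => sym (l env) (y env) (i env) (u env)).
Proof.
move=> hl hy hi hu.
have hp := rep_pos hl hi hu.
apply: (@rep_prec u (fun env => initial_sym (y env) (i env) (pos (l env) (i env) (u env)) (u env))
  (fun k r env => if pos (l env) (i env) (u env) + k == pos (l env) (i env) k + u env
     then f_write (get (l env) k) (i env) else r)); first by [].
  by rewrite /initial_sym; rep_auto.
have hp' : rep (fun env => pos (l (behead (behead env))) (i (behead (behead env)))
   (nth 0 env 1)) by apply: rep_pos; rep_auto.
have hp2 := rep_weaken (rep_weaken hp).
apply: rep_if; [|rep_auto|rep_auto].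
by apply: rep_eqn; apply: rep_add; try exact: hp2; try exact: hp'; rep_auto.
Qed.

Lemma rep_valid e y c : rep e -> rep y -> rep c ->
  rep (fun env => valid (e env) (y env) (c env)).
Proof.
move=> he hy hc; rewrite /valid.
apply: rep_and; first by rep_auto.
apply: rep_and; first by rep_auto.
apply: rep_and; last by rep_auto.
apply: (@rep_all (fun u env => valid_step (e env) (y env) (psnd (c env)) (pfst (c env)) u)
  (fun env => pfst (c env))); first by rep_auto.
apply: rep_and.
  apply: (@rep_has (fun k env => get (get (e (behead env)) 2) k ==
    get (psnd (c (behead env))) (nth 0 env 0)) (fun env => get (e (behead env)) 1));
    by rep_auto.
apply: rep_and; last first.
  by apply: rep_ifb; rep_auto.
apply: (@rep_all (fun i env => f_read (get (psnd (c (behead env))) (nth 0 env 0)) i ==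
      sym (psnd (c (behead env))) (y (behead env)) i (nth 0 env 0))
      (fun env => get (e (behead env)) 0)); first by rep_auto.
apply: rep_eqn; first by rep_auto.
by apply: rep_sym; rep_auto.
Qed.

Lemma rep_acts e h N : rep e -> rep h -> rep N ->
  rep (fun env => acts (e env) (h env) (N env)).
Proof.
move=> he hh hN; apply: rep_and.
  apply: (@rep_all (fun i env => pfst (get (h env) i) != 2 * e env + 1) N) => //.
  by rep_auto.
apply: (@rep_has (fun i env => (2 * e env + 1 < pfst (get (h env) i))
   && has (valid (e env) (psnd (get (h env) i))) (iota 0 (N env))) N) => //.
apply: rep_and; first by rep_auto.
apply: (@rep_has (fun c env => valid (e (behead env))
   (psnd (get (h (behead env)) (nth 0 env 0))) c) (fun env => N (behead env))).
  by rep_auto.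
by apply: rep_valid; rep_auto.
Qed.

Lemma rep_pick h N : rep h -> rep N -> rep (fun env => pick (h env) (N env)).
Proof.
move=> hh hN.
have hf : rep (fun env => find (fun e => acts e (h env) (N env)) (iota 0 (N env))).
  apply: (@rep_find (fun e env => acts e (h env) (N env)) N) => //.
  by apply: rep_acts; rep_auto.
rewrite /pick; apply: rep_if; last by rep_auto.
  by apply: rep_leq => //; apply: rep_succ.
by apply: rep_add; [apply: rep_mul|]; rep_auto.
Qed.

(** One exponential more than in [double_exp]: [2 ^ k] eventually exceeds every multiple of [k], so
    one machine serves all [alpha]. *)
Definition tower k := 2 ^ (2 ^ (2 ^ k)).

Lemma tower_term_ex : exists t, forall k, eval t [:: k] = tower k.
Proof.
have [t ht] : rep (fun env => tower (nth 0 env 0)).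
  by do 3 apply: rep_exp2; exact: rep_nth.
by exists t => k; rewrite ht.
Qed.

Lemma push_term_ex :
  exists t, forall v N h, eval t [:: v; N; h] = cpair (cpair v N) h.
Proof.
have [t ht] : rep (fun env => cpair (cpair (nth 0 env 0) (nth 0 env 1)) (nth 0 env 2)).
  by rep_auto.
by exists t => v N h; rewrite ht.
Qed.

Lemma pick_term_ex : exists t, forall h N, eval t [:: h; N] = pick h N.
Proof.
have [t ht] := rep_pick (rep_nth 0) (rep_nth 1).
by exists t => h N; rewrite ht.
Qed.

(** The terms stay abstract: the clock accounts for whatever their evaluation costs, so only their
    values matter. *)
Definition tower_term := sval (cid tower_term_ex).
Definition push_term := sval (cid push_term_ex).
Definition pick_term := sval (cid pick_term_ex).

Lemma eval_tower k : eval tower_term [:: k] = tower k.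
Proof. exact: (svalP (cid tower_term_ex)). Qed.
Lemma eval_push v N h : eval push_term [:: v; N; h] = cpair (cpair v N) h.
Proof. exact: (svalP (cid push_term_ex)). Qed.
Lemma eval_pick h N : eval pick_term [:: h; N] = pick h N.
Proof. exact: (svalP (cid pick_term_ex)). Qed.

Record stage := Stage { clock : nat; history : nat; value : nat; bound : nat }.

(** The clock is the cost of the three assignments of this round alone; producing [tower k] makes it
    at least double. The bound grows before it is stored, so stage [j] comes with the length
    [bnd j.+1]. *)
Definition next_stage (S : stage) : stage :=
  let: Stage k h v N := S in
  let k1 := assign_cost 0 tower_term [:: k] in
  let N' := N + tower k in
  let h' := cpair (cpair v N') h in
  let k2 := k1 + assign_cost h push_term [:: v; N'; h] in
  let v' := pick h' N' in
  Stage (k2 + assign_cost v pick_term [:: h'; N']) h' v' N'.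

(* Registers: 0 the remaining input, 1 the clock, 2 cleared to accept, 3 cleared
   at the stage selected by the input, 4 the value at that stage, 5 the history,
   6 the value, 8 the bound; 7, 9, 10 and beyond are scratch. *)
Definition drain r t := While r (Seq (Dec r) (Dec t)).

(** Moving the old clock to register 7 lets register 1 count afresh. The loop on 9 extends the bound
    and consumes input; when the input is first used up, the current value is saved in register 4.
    The final drains bring register 2 from 1 to 0 exactly if the saved value exceeds the new one. *)
Definition body : cmd :=
  Seq (move_reg 1 7) (Seq (tick 1 (assign 9 [:: 7] 11 tower_term))
  (Seq (clear 7) (Seq (While 9 (Seq (Dec 9) (Seq (Inc 8) (Dec 0))))
  (Seq (Ifz 0 (While 3 (Seq (Dec 3) (copy 6 4 10))))
  (Seq (tick 1 (assign 5 [:: 6; 8; 5] 11 push_term))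
  (Seq (tick 1 (assign 6 [:: 5; 8] 11 pick_term))
  (Seq (copy 6 9 10) (Seq (copy 4 7 10) (Seq (drain 9 7) (drain 7 2)))))))))).

Definition program : cmd :=
  Seq (Inc 1) (Seq (Inc 2) (Seq (Inc 3) (While 2 body))).

Lemma exec_drain r t s : r != t ->
  exec (drain r t) s (3 * s r + 1) (upd (upd s r 0) t (s t - s r)).
Proof.
move=> /eqP rt; move e: (s r) => n; elim: n s e => [|n IH] s e.
  apply: execE (ExecWhile0 _ e) _ _ => // i; upd_simpl.
apply: execE (ExecWhileS _ (ExecSeq (ExecDec _ _) (ExecDec _ _)) (IH _ _)) _ _;
  rewrite ?e //.
- upd_simpl.
- lia.
- move=> i; upd_simpl.
Qed.

Lemma exec_absorb s :
  exec (While 9 (Seq (Dec 9) (Seq (Inc 8) (Dec 0)))) s (4 * s 9 + 1)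
    (upd (upd (upd s 9 0) 8 (s 8 + s 9)) 0 (s 0 - s 9)).
Proof.
move e: (s 9) => n; elim: n s e => [|n IH] s e.
  apply: execE (ExecWhile0 _ e) _ _ => // i; upd_simpl.
apply: execE (ExecWhileS _ (ExecSeq (ExecDec _ _) (ExecSeq (ExecInc _ _)
  (ExecDec _ _))) (IH _ _)) _ _; rewrite ?e //.
- lia.
- move=> i; upd_simpl.
Qed.

Definition regs (l : seq nat) : mem := nth 0 l.

Ltac regs_eq :=
  rewrite /regs /upd; do 11 (case; [by rewrite /=; lia|]); intro;
  rewrite /= ?nth_nil //; lia.

Lemma exec_body x f e S :
  (f == 0) || (f == 1) ->
  let S' := next_stage S in
  let x' := x - tower (clock S) in
  let sel := (x' == 0) && (f == 1) in
  let f' := if sel then 0 else f in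
  let e' := if sel then e + value S else e in
  exists2 T,
    exec body (regs [:: x; clock S; 1; f; e; history S; value S; 0; bound S]) T
      (regs [:: x'; clock S'; 1 - (e' - value S'); f'; e'; history S'; value S';
                0; bound S']) &
    T <= 2 * clock S' + 5 * clock S + 4 * tower (clock S) + 7 * value S
         + 10 * value S' + 10 * e' + 30.
Proof.
case: S => k h v N hf /=.
set g := tower k; set k1 := assign_cost 0 tower_term [:: k].
set N' := N + g; set h' := cpair (cpair v N') h.
set k2 := k1 + _; set v' := pick h' N'; set k3 := k2 + _.
set x' := x - g; set sel := _ && _; set f' := if sel then 0 else f.
set e' := if sel then _ else _.
have hz (l : seq nat) r : size l <= 11 -> 11 <= r -> regs l r = 0.
  by move=> sl hr; rewrite /regs nth_default //; lia.
have s1 : exec (move_reg 1 7) (regs [:: x; k; 1; f; e; h; v; 0; N]) (3 * k + 1)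
    (regs [:: x; 0; 1; f; e; h; v; k; N]).
  by apply: execE (exec_move _ _) _ _ => //; regs_eq.
have s2 : exec (tick 1 (assign 9 [:: 7] 11 tower_term))
    (regs [:: x; 0; 1; f; e; h; v; k; N]) (2 * k1)
    (regs [:: x; k1; 1; f; e; h; v; k; N; g]).
  apply: execE (exec_tick_assign _ _ _ _ _ _ _) _ _ => //; first by move=> r; apply: hz.
  by rewrite /= /regs /= eval_tower; regs_eq.
have s3 : exec (clear 7) (regs [:: x; k1; 1; f; e; h; v; k; N; g]) (2 * k + 1)
   (regs [:: x; k1; 1; f; e; h; v; 0; N; g]).
  by apply: execE (exec_clear _ _) _ _ => //; regs_eq.
have s4 := exec_absorb (regs [:: x; k1; 1; f; e; h; v; 0; N; g]).
have e4 : upd (upd (upd (regs [:: x; k1; 1; f; e; h; v; 0; N; g]) 9 0) 8 (N + g)) 0 x'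
   = regs [:: x'; k1; 1; f; e; h; v; 0; N'].
  by apply/funext; regs_eq.
rewrite [regs _ 9]/regs [regs _ 8]/regs [regs _ 0]/regs /= in s4.
rewrite e4 {e4} in s4.
have [T5 s5 b5] : exists2 T, exec (Ifz 0 (While 3 (Seq (Dec 3) (copy 6 4 10))))
    (regs [:: x'; k1; 1; f; e; h; v; 0; N']) T
    (regs [:: x'; k1; 1; f'; e'; h; v; 0; N']) & T <= 7 * v + 6.
  rewrite /f' /e' /sel; case: (eqVneq x' 0) => [x0|x0] /=; last first.
    by exists 1; [apply: ExecIfzS|lia].
  case/orP: hf => /eqP ->.
    by exists 2; [apply: ExecIfz0 => //; apply: ExecWhile0|lia].
  exists (1 + (7 * v + 2) + 1).+2; last by lia.
  apply: ExecIfz0 => //.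
  apply: ExecWhileS => //; last by apply: ExecWhile0.
  apply: exec_seq (ExecDec _ _) _ erefl.
  by apply: execE (exec_copy _ _ _ _) _ _ => //; regs_eq.
have s6 : exec (tick 1 (assign 5 [:: 6; 8; 5] 11 push_term))
    (regs [:: x'; k1; 1; f'; e'; h; v; 0; N']) (2 * (k2 - k1))
    (regs [:: x'; k2; 1; f'; e'; h'; v; 0; N']).
  apply: execE (exec_tick_assign _ _ _ _ _ _ _) _ _ => //; first by move=> r; apply: hz.
    by rewrite /k2 addKn.
  by rewrite /= /regs /= eval_push -/h' -/k2; regs_eq.
have s7 : exec (tick 1 (assign 6 [:: 5; 8] 11 pick_term))
    (regs [:: x'; k2; 1; f'; e'; h'; v; 0; N']) (2 * (k3 - k2))
    (regs [:: x'; k3; 1; f'; e'; h'; v'; 0; N']).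
  apply: execE (exec_tick_assign _ _ _ _ _ _ _) _ _ => //; first by move=> r; apply: hz.
    by rewrite /k3 addKn.
  by rewrite /= /regs /= eval_pick -/v' -/k3; regs_eq.
have s8 : exec (copy 6 9 10) (regs [:: x'; k3; 1; f'; e'; h'; v'; 0; N']) (7 * v' + 2)
    (regs [:: x'; k3; 1; f'; e'; h'; v'; 0; N'; v']).
  by apply: execE (exec_copy _ _ _ _) _ _ => //; regs_eq.
have s9 : exec (copy 4 7 10) (regs [:: x'; k3; 1; f'; e'; h'; v'; 0; N'; v'])
    (7 * e' + 2) (regs [:: x'; k3; 1; f'; e'; h'; v'; e'; N'; v']).
  by apply: execE (exec_copy _ _ _ _) _ _ => //; regs_eq.
have s10 : exec (drain 9 7) (regs [:: x'; k3; 1; f'; e'; h'; v'; e'; N'; v'])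
    (3 * v' + 1) (regs [:: x'; k3; 1; f'; e'; h'; v'; e' - v'; N']).
  by apply: execE (exec_drain _ _) _ _ => //; regs_eq.
have s11 : exec (drain 7 2) (regs [:: x'; k3; 1; f'; e'; h'; v'; e' - v'; N'])
    (3 * (e' - v') + 1) (regs [:: x'; k3; 1 - (e' - v'); f'; e'; h'; v'; 0; N']).
  by apply: execE (exec_drain _ _) _ _ => //; regs_eq.
eexists; first exact: ExecSeq s1 (ExecSeq s2 (ExecSeq s3 (ExecSeq s4 (ExecSeq s5
  (ExecSeq s6 (ExecSeq s7 (ExecSeq s8 (ExecSeq s9 (ExecSeq s10 s11))))))))).
have : k1 <= k2 by apply: leq_addr.
have : k2 <= k3 by apply: leq_addr.
by clearbody k1 k2 k3 v' e' g N' h'; lia.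
Qed.

(** * Growth of the stages *)

Definition stages j := iter j next_stage (Stage 1 0 0 0).
Notation clk j := (clock (stages j)).
Notation hist j := (history (stages j)).
Notation vals j := (value (stages j)).
Notation bnd j := (bound (stages j)).

Lemma stagesS j : stages j.+1 = next_stage (stages j).
Proof. by []. Qed.

Lemma bndS j : bnd j.+1 = bnd j + tower (clk j).
Proof. by rewrite stagesS; case: (stages j). Qed.

Lemma histS j : hist j.+1 = cpair (cpair (vals j) (bnd j.+1)) (hist j).
Proof. by rewrite stagesS; case: (stages j). Qed.

Lemma valsS j : vals j.+1 = pick (hist j.+1) (bnd j.+1).
Proof. by rewrite stagesS; case: (stages j). Qed.

(** The result is moved to its register by unit steps. *)
Lemma eval_le_assign_cost o t env : eval t env <= assign_cost o t env.
Proof. rewrite /assign_cost; lia. Qed.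

Lemma tower_clk j : tower (clk j) <= clk j.+1.
Proof.
rewrite stagesS; case: (stages j) => k h v N /=; rewrite -{1}eval_tower -addnA.
exact: leq_trans (eval_le_assign_cost 0 _ _) (leq_addr _ _).
Qed.

Lemma exp2_le_tower k : 2 ^ k <= tower k.
Proof.
have h n : n <= 2 ^ n by apply: ltnW; apply: ltn_expl.
by apply: leq_trans (h _) _; apply: h.
Qed.

Lemma double_le_tower k : 0 < k -> 2 * k <= tower k.
Proof.
move=> k0; apply: leq_trans (exp2_le_tower k); elim: k k0 => // -[//|k] IH _.
have := IH isT; rewrite [2 ^ k.+2]expnS; lia.
Qed.

Lemma clk_gt0 j : 0 < clk j.
Proof.
elim: j => // j IH; apply: leq_trans (tower_clk j).
by rewrite expn_gt0.
Qed.

Lemma clk_double j : 2 * clk j <= clk j.+1.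
Proof. exact: leq_trans (double_le_tower (clk_gt0 j)) (tower_clk j). Qed.

Lemma clk_mono i j : i <= j -> clk i <= clk j.
Proof.
move=> /subnK <-; elim: (j - i) => // d IH; rewrite addSn.
have := clk_double (d + i); lia.
Qed.

Lemma leq_clk j : j <= clk j.
Proof. by elim: j => // j IH; have := clk_double j; have := clk_gt0 j; lia. Qed.

Lemma vals_le_clk j : vals j <= clk j.
Proof.
case: j => [|j] //; rewrite stagesS; case: (stages j) => k h v N /=.
rewrite -eval_pick; exact: leq_trans (eval_le_assign_cost v _ _) (leq_addl _ _).
Qed.

Lemma bnd_lt j : bnd j < bnd j.+1.
Proof. by rewrite bndS -[X in X < _]addn0 ltn_add2l expn_gt0. Qed.

Lemma bnd_mono i j : i < j -> bnd i < bnd j.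
Proof.
move=> /subnK <-; elim: (j - i.+1) => [|d IH]; first exact: bnd_lt.
by rewrite addSn; apply: ltn_trans IH (bnd_lt _).
Qed.

Lemma leq_bnd j : j <= bnd j.
Proof. by elim: j => // j IH; apply: leq_ltn_trans IH (bnd_lt j). Qed.

Lemma tower_le_bnd j : tower (clk j) <= bnd j.+1.
Proof. by rewrite bndS leq_addl. Qed.

(** * Running the program *)

(* An input of length [n] is processed as the stage [s] with
   [bnd s < n <= bnd s.+1] (with [n <= bnd 1] for [s = 0]). *)
Definition selects n s := (forall j, j < s -> bnd j.+1 < n) /\ n <= bnd s.+1.

Lemma selects_ex n : exists s, selects n s.
Proof.
have h : exists s, n <= bnd s.+1 by exists n; apply: leq_trans (leq_bnd n) (ltnW (bnd_lt n)).
case: (ex_minnP h) => s hs hmin; exists s; split=> // j js.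
by rewrite ltnNge; apply/negP => /hmin; rewrite leqNgt js.
Qed.

(** Until stage [s] is over nothing has been saved, and 0 never exceeds a new value, so the loop
    goes on. *)
Definition selected s j := if j <= s then 0 else vals s.

Definition loop_regs n s j g : mem :=
  regs [:: n - bnd j; clk j; g; (j <= s : nat); selected s j; hist j; vals j; 0; bnd j].

(** Amortization: the body costs a linear amount in the old and the new clock, and the clock at
    least doubles, so 130 times its increase pays for the round. *)
Lemma exec_loop_body n s j : selects n s ->
  exists2 T,
    exec body (loop_regs n s j 1) T
      (loop_regs n s j.+1 (1 - (selected s j.+1 - vals j.+1))) &
    130 * clk j + T.+1 <= 130 * clk j.+1.
Proof.
move=> [hs1 hs2].
have f01 : (nat_of_bool (j <= s) == 0) || (nat_of_bool (j <= s) == 1).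
  by case: (j <= s).
have := @exec_body (n - bnd j) _ (selected s j) (stages j) f01.
rewrite -stagesS -subnDA -bndS /=.
set sel := (_ == 0) && _.
have -> : sel = (j == s).
  rewrite /sel; case: (ltngtP j s) => js; rewrite ?andbF ?andbT //.
    by apply/negbTE; rewrite -lt0n subn_gt0 hs1.
  by subst j; rewrite subn_eq0 hs2.
have -> : (if j == s then selected s j + vals j else selected s j) = selected s j.+1.
  by rewrite /selected; case: (ltngtP j s) => // ->.
have -> : (if j == s then 0 else nat_of_bool (j <= s)) = (j < s).
  by case: (ltngtP j s).
move=> [T hT bT]; exists T; first by [].
have := tower_clk j; have := clk_double j; have := clk_gt0 j.
have := vals_le_clk j; have := vals_le_clk j.+1.
have : selected s j.+1 <= clk j.+1.
  rewrite /selected; case: leqP => // sj.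
  by apply: leq_trans (vals_le_clk s) (clk_mono _); apply: ltnW.
move: bT; rewrite -?stagesS; lia.
Qed.

Definition input_mem n : mem := fun r => if r == 0 then n else 0.

Notation program_start := (Some (entry program)).
Notation loop_point := (Some (inr (inr (inr None)) : point program)).

(** The lower bound on [T] will show that an unstopped loop runs forever; the upper bound gives the
    acceptance time. *)
Lemma goes_loop n s j : selects n s ->
  (forall t, s < t <= j -> vals s <= vals t) ->
  exists2 T, @goes program program_start (input_mem n) T loop_point
    (loop_regs n s j 1) & j <= T <= 130 * clk j.
Proof.
move=> hs; elim: j => [|j IH] hv.
  exists 3 => //; do 3 (apply: GoesS => /=).
  rewrite (_ : upd _ _ _ = loop_regs n s 0 1); first exact: Goes0.
  by apply/funext; rewrite /loop_regs /selected /stages /= subn0 /input_mem; regs_eq.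
have [t ht|T hT bT] := IH; first by apply: hv; lia.
have [T1 hT1 bT1] := exec_loop_body j hs.
have e0 : selected s j.+1 - vals j.+1 = 0.
  rewrite /selected; case: ifP => // /negbT; rewrite -ltnNge => sj.
  by apply/eqP; rewrite subn_eq0 hv // sj leqnn.
rewrite e0 subn0 in hT1.
have h := @goes_iteration 2 _ _ _ _ _ hT1.
exists (T + T1.+1); last by lia.
apply: goes_trans hT _.
exact: (goes_seqr _ (goes_seqr _ (goes_seqr _ (h isT)))).
Qed.

(** The loop stops at the least witness [t0], which is at most [t]; the extra step is the last
    test. *)
Lemma goes_accept n s t : selects n s -> s < t -> vals t < vals s ->
  exists T s', @goes program program_start (input_mem n) T None s'
    /\ T <= 130 * clk t + 1.
Proof.
move=> hs st vt.
have : exists t, (s < t) && (vals t < vals s) by exists t; rewrite st vt.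
case/ex_minnP => t0 /andP[st0 vt0] tmin.
have t0t : t0 <= t by apply: tmin; rewrite st vt.
have e : t0 = t0.-1.+1 by lia.
have [u hu|T hT bT] := @goes_loop n s t0.-1 hs.
  rewrite leqNgt; apply/negP => vu.
  by have := tmin u; rewrite vu andbT; lia.
have [T1 hT1 bT1] := exec_loop_body t0.-1 hs.
rewrite -e in hT1 bT1.
have e0 : 1 - (selected s t0 - vals t0) = 0 by rewrite /selected leqNgt st0 /=; lia.
rewrite e0 in hT1.
have h := @goes_iteration 2 _ _ _ _ _ hT1.
exists (T + (T1.+1 + 1)), (loop_regs n s t0 0); split; last first.
  have := clk_mono t0t; lia.
apply: goes_trans hT _.
have stop : @goes (While 2 body) (Some None) (loop_regs n s t0 0) 1 None
  (loop_regs n s t0 0) by apply: GoesS; apply: Goes0.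
by have := goes_seqr (Inc 1) (goes_seqr (Inc 2) (goes_seqr (Inc 3)
  (goes_trans (h isT) stop))).
Qed.

(** Without a witness the loop test is reached after arbitrarily many steps, which by determinism
    excludes a finished run. *)
Lemma goes_program n s : selects n s ->
  (exists T s', @goes program program_start (input_mem n) T None s') ->
  exists2 t, s < t & vals t < vals s.
Proof.
move=> hs [T [s' hT]]; case: (pselect (exists2 t, s < t & vals t < vals s)) => // no.
have [t /andP[st _]|T1 hT1 bT1] := @goes_loop n s T.+1 hs.
  by rewrite leqNgt; apply/negP => vt; apply: no; exists t.
have le : T <= T1 by lia.
by have /goes_end := goes_det hT hT1 le; lia.
Qed.

Lemma increments_program : ~~ increments 0 program.
Proof.
have a x rho t : x != 0 -> 0 \notin rho -> increments 0 (tick 1 (assign x rho 11 t)) = false.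
  move=> x0 r0; rewrite increments_tick //; apply/negbTE/increments_mentions.
  by apply: mentions_assign; rewrite // eq_sym.
have seqE c d : increments 0 (Seq c d) = increments 0 c || increments 0 d by [].
have whileE r c : increments 0 (While r c) = increments 0 c by [].
by rewrite /program /body !(seqE, whileE, a).
Qed.

(** * Diagonalization *)

Definition deficient s := exists2 t, s < t & vals t < vals s.

Lemma get_hist j i :
  get (hist j) i = if i < j then cpair (vals (j - i.+1)) (bnd (j - i)) else 0.
Proof.
elim: j i => [|j IH] i; first by rewrite /= get0.
rewrite histS; case: i => [|i]; first by rewrite get_pair0 subn1 subn0.
by rewrite get_pairS IH ltnS !subSS.
Qed.

Lemma pfst0 : pfst 0 = 0.
Proof. exact: (pfstE 0 0). Qed.

(** The history lists the latest stage first. Searching up to [bnd j] covers it, since [j <= bnd j];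
    entries past its end are 0 and trigger nothing. *)
Lemma actsP e j : acts e (hist j) (bnd j) <->
  (forall u, u < j -> vals u <> 2 * e + 1) /\
  exists u c, [/\ u < j, 2 * e + 1 < vals u, c < bnd j & valid e (bnd u.+1) c].
Proof.
have entry u : u < j -> get (hist j) (j - u.+1) = cpair (vals u) (bnd u.+1).
  move=> uj; rewrite get_hist (_ : j - u.+1 < j); last by lia.
  by congr (cpair (vals _) (bnd _)); lia.
split=> [/andP[/allP h1 /hasP[i]]|[h1 [u [c [uj lu cj hc]]]]].
  rewrite mem_iota add0n => /= ij /andP[]; rewrite get_hist.
  case: (ltnP i j) => [ltij|_]; last by rewrite pfst0.
  rewrite pfstE psndE => lu /hasP[c]; rewrite mem_iota add0n /= => cj hc.
  split=> [u uj eu|].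
    have := h1 (j - u.+1); rewrite mem_iota entry // pfstE eu eqxx.
    by have := leq_bnd j; lia.
  have e1 : (j - i.+1).+1 = j - i by lia.
  exists (j - i.+1), c; split=> //; first by lia.
  by rewrite -stagesS e1.
apply/andP; split.
  apply/allP => i _; rewrite get_hist; case: (ltnP i j) => [ltij|_].
    by rewrite pfstE; apply/eqP/h1; lia.
  by rewrite pfst0; lia.
apply/hasP; exists (j - u.+1); first by rewrite mem_iota; have := leq_bnd j; lia.
rewrite entry // pfstE psndE lu /=; apply/hasP; exists c => //.
by rewrite mem_iota.
Qed.

Variant pick_spec h N : nat -> Prop :=
  | PickAct e of e < N & acts e h N & (forall e', e' < e -> ~~ acts e' h N) :
      pick_spec h N (2 * e + 1)
  | PickDefault of (forall e, e < N -> ~~ acts e h N) : pick_spec h N (2 * N).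

Lemma pickP h N : pick_spec h N (pick h N).
Proof.
rewrite /pick; set k := find _ _.
case: ltnP => kN.
  have hs : has (fun e => acts e h N) (iota 0 N) by rewrite has_find size_iota.
  apply: PickAct => //.
    by have := nth_find 0 hs; rewrite nth_iota.
  by move=> e ek; have := before_find 0 ek; rewrite nth_iota ?add0n => [->|]; lia.
apply: PickDefault => e eN; apply/negP => ae.
have : has (fun e => acts e h N) (iota 0 N).
  by apply/hasP; exists e => //; rewrite mem_iota.
by rewrite has_find size_iota ltnNge kN.
Qed.

Lemma vals_cases j :
  (vals j = 2 * bnd j /\ forall e, e < bnd j -> ~~ acts e (hist j) (bnd j)) \/
  exists e, [/\ vals j = 2 * e + 1, acts e (hist j) (bnd j) &
      forall e', e' < e -> ~~ acts e' (hist j) (bnd j)].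
Proof.
case: j => [|j]; first by left.
by rewrite valsS; case: pickP => [e _ ae me|]; [right; exists e|left].
Qed.

Lemma vals_inj i j : i < j -> vals i <> vals j.
Proof.
move=> ij; have bij := bnd_mono ij.
case: (vals_cases j) => [[-> _]|[e [-> /actsP[h _] _]]]; last exact: h.
by case: (vals_cases i) => [[-> _]|[e [-> _ _]]]; lia.
Qed.

(** By injectivity each number is taken at most once, so the values leave every initial segment for
    good. *)
Lemma vals_unbounded b : exists k, forall t, k <= t -> b <= vals t.
Proof.
elim: b => [|b [k hk]]; first by exists 0.
case: (pselect (exists2 t, k <= t & vals t = b)) => [[t kt vt]|no].
  exists t.+1 => u tu; rewrite ltn_neqAle hk ?andbT; last by lia.
  by apply/eqP; rewrite -vt; apply: vals_inj.
exists k => u ku; rewrite ltn_neqAle hk // andbT.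
by apply/eqP => e; apply: no; exists u.
Qed.

(** A stage taking the least value among those from [k] on is true. *)
Lemma true_stage k : exists2 s, k <= s & ~ deficient s.
Proof.
have : exists b, `[< exists2 t, k <= t & vals t = b >].
  by exists (vals k); apply/asboolP; exists k.
case/ex_minnP => b /asboolP[s ks vs] bmin; exists s => // -[t st vt].
have := bmin (vals t); rewrite leqNgt -vs vt => /(_ _)/notF; apply.
by apply/asboolP; exists t => //; lia.
Qed.

(** If [2 * e + 1] were output, the stage that triggered it would be both rejected and deficient. If
    it never is, a true stage with a larger value is rejected, so [acts] holds for [e] at late
    stages; their values are then at most [2 * e + 1], although the values tend to infinity. *)
Lemma diagonal e :
  ~ (forall s, (exists c, valid e (bnd s.+1) c) <-> ~ deficient s).
Proof.
move=> h.
have noact t : vals t <> 2 * e + 1.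
  move=> vt; case: (vals_cases t) => [[]|[e' []]]; first by lia.
  rewrite vt => ee' /actsP[_ [u [c [ut lu _ hc]]]] _.
  have ? : e' = e by lia.
  subst e'; apply: (h u).1; first by exists c.
  by exists t => //; rewrite vt.
have [k hk] := vals_unbounded (2 * e + 2).
have [s ks ts] := true_stage k.
have [c hc] := (h s).2 ts.
(* Stage [j] is late enough for large values, comes after [s], and its bound exceeds both [e] and
   the trace code [c]. *)
set j := maxn (maxn k s.+1) (maxn e.+1 c.+1).
have bj := leq_bnd j.
have ae : acts e (hist j) (bnd j).
  apply/actsP; split=> [u _|]; first exact: noact.
  by exists s, c; have := hk s ks; split=> //; lia.
have := hk j; case: (vals_cases j) => [[_ no]|[e' [-> _ me]]].
  by have := no e; rewrite ae; lia.
case: (ltnP e e') => [/me|]; first by rewrite ae.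
by lia.
Qed.

Import Order.TTheory GRing.Theory Num.Theory.

(** * Counter programs as Turing machines *)

(* Register [0] is the number of unread input letters; every other register is
   the head position of a tape whose cell [0] is marked in the first step. *)
Definition scan_nonzero (K : nat) (v : {ffun 'I_K.+1 -> option bool}) (r : nat) :=
  if r == 0 then v ord0 != None else v (inord r) != Some true.

Definition head_move (K : nat) (v : {ffun 'I_K.+1 -> option bool}) (x : action)
    (i : 'I_K.+1) : move :=
  match x with
  | None => Stay
  | Some (b, r) =>
      if i != r :> nat then Stay
      else if b then MoveRight
      else if scan_nonzero v r then (if r == 0 then MoveRight else MoveLeft)
      else Stay
  end.

(** State [None] is initial and only marks tapes, [Some None] is accepting, and [Some (Some p)] is
    the control point [p]. *)
Definition machine_delta (c : cmd) (q : option (option (point c)))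
    (v : {ffun 'I_(max_reg c).+1 -> option bool}) :
    option (option (option (point c)) * {ffun 'I_(max_reg c).+1 -> option bool} *
      {ffun 'I_(max_reg c).+1 -> move}) :=
  match q with
  | None =>
      Some (Some (Some (entry c)), [ffun i => if i == ord0 then v i else Some true],
            [ffun=> Stay])
  | Some None => None
  | Some (Some p) =>
      let: (x, o) := next (scan_nonzero v) p in
      Some (Some o, v, [ffun i => head_move v x i])
  end.

Definition machine_trans (c : cmd) q v a := `[< Some a = @machine_delta c q v >].

Lemma some_letter_inj : injective (@Some bool).
Proof. by move=> x y []. Qed.

Lemma some_letter_neq_blank (b : bool) : Some b != None.
Proof. by []. Qed.

Lemma machine_accept_halts c v a : ~~ @machine_trans c (Some None) v a.
Proof. by apply/asboolPn. Qed.

Definition machine (c : cmd) : TM :=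
  @MkTM (max_reg c) (option (option (point c))) (option bool) None (@Some bool)
    None (Some None) (@machine_trans c) some_letter_inj some_letter_neq_blank
    (@machine_accept_halts c).

(** The tapes no longer change after the first step: the memory is held by the head positions
    alone. *)
Definition tape_content c (w : seq bool) (i : tape_index (machine c)) (z : int) :
    symbol (machine c) :=
  if i == ord0 then (if (0 <= z)%R then nth None (map some w) `|z|%N else None)
  else if z == 0%R then Some true else None.

Definition tape_head c (w : seq bool) (s : mem) (i : tape_index (machine c)) : int :=
  if i == ord0 then Posz (size w - s 0) else Posz (s i).

Definition tm_config c w o s : config (machine c) :=
  @Config (machine c) (Some o) (@tape_content c w) (tape_head w s).

Lemma scan_nonzeroE c w o s r : s 0 <= size w -> r <= max_reg c ->
  scan_nonzero (scanned (@tm_config c w o s)) r = nonzero s r.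
Proof.
move=> sw rc; rewrite /scan_nonzero /nonzero; case: eqP => [->|/eqP r0].
  rewrite ffunE /= /tape_content /tape_head /= -lt0n.
  case: (posnP (s 0)) => [->|h].
    by rewrite subn0 nth_default ?size_map ?eqxx.
  rewrite (nth_map true) //; lia.
rewrite ffunE /= /tape_content /tape_head.
have -> : inord r == ord0 :> 'I_(max_reg c).+1 = false.
  by apply/negbTE; rewrite -val_eqE /= inordK.
by rewrite inordK //; case: (s r).
Qed.

(** The bound [s 0 <= size w] keeps the input head position [size w - s 0] exact; it persists
    because register 0 is never incremented. *)
Lemma machine_step c w p s (d' : config (machine c)) :
  ~~ increments 0 c -> s 0 <= size w ->
  let: (x, o) := next (nonzero s) p in
  (step (tm_config w (Some p) s) d' <->
     d' = tm_config w o (apply_action x s)) /\ apply_action x s 0 <= size w.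
Proof.
move=> i0 sw; case E: (next _ p) => [x o].
have E' : next (scan_nonzero (scanned (tm_config w (Some p) s))) p = (x, o).
  by rewrite -E; apply: eq_next => r hr; rewrite scan_nonzeroE.
have hx : apply_action x s 0 <= size w.
  case: x E {E'} => [[b r]|] //= /next_reg /andP[_].
  by case: b => /=; rewrite /upd; case: eqP => // <-; [rewrite (negbTE i0)|lia].
split=> //.
have key : @perform (machine c) (Some o, scanned (tm_config w (Some p) s),
     [ffun i => head_move (scanned (tm_config w (Some p) s)) x i])
     (tm_config w (Some p) s) = tm_config w o (apply_action x s).
  rewrite /perform /=; congr Config.
    apply/funext => i; apply/funext => z; rewrite ffunE /=.
    by case: eqP => // ->.
  apply/funext => i; rewrite ffunE /= /tape_head.
  case: x E {E'} hx => [[b r]|] /=; last by rewrite addr0.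
  move=> /next_reg /andP[rc br] hx.
  case: (eqVneq (i : nat) r) => [ir|ir] /=; last first.
    rewrite addr0; case: ifP => [/eqP i00|_].
      by case: (b); rewrite /upd; move: ir; rewrite i00 /= => /negbTE ->.
    by case: (b); rewrite /upd (negbTE ir).
  rewrite scan_nonzeroE // /nonzero; case: b br hx => /= br hx.
    have r0 : r != 0 by apply: contraNneq i0 => <-.
    have -> : (i == ord0) = false by rewrite -val_eqE /= ir (negbTE r0).
    by rewrite ir /upd eqxx /=; lia.
  rewrite -val_eqE /= ir; case: eqP => [r0|r0].
    by subst r; rewrite r0 /upd eqxx; case: (eqVneq (s 0) 0) => h /=; lia.
  by rewrite /upd eqxx; case: (eqVneq (s r) 0) => h /=; lia.
split=> [[a]|->].
  move=> /asboolP /=; rewrite E' => -[->] ->; exact: key.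
exists (Some o, scanned (tm_config w (Some p) s),
     [ffun i => head_move (scanned (tm_config w (Some p) s)) x i]) => //.
by apply/asboolP => /=; rewrite E'.
Qed.

Lemma machine_first_step c w (d' : config (machine c)) :
  step (initial (machine c) w) d' <->
  d' = tm_config w (Some (entry c)) (fun r => if r == 0 then size w else 0).
Proof.
set v := scanned (initial (machine c) w).
have key : @perform (machine c)
    (Some (Some (entry c)), [ffun i => if i == ord0 then v i else Some true],
     [ffun=> Stay]) (initial (machine c) w) =
   tm_config w (Some (entry c)) (fun r => if r == 0 then size w else 0).
  rewrite /perform /=; congr Config.
    apply/funext => i; apply/funext => z; rewrite ffunE /tape_content /= /v ffunE /=.
    case: (eqVneq i ord0) => [e|i0] /=; last by [].
    by case: eqP => // ->.
  apply/funext => i; rewrite ffunE /tape_head /= add0r subnn.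
  case: eqP => // /eqP; rewrite -val_eqE /= => /negbTE -> //.
split=> [[a]|->].
  by move=> /asboolP /= [->] ->; exact: key.
by eexists; last exact: esym key; apply/asboolP.
Qed.

Lemma machine_computes c w o s n (d' : config (machine c)) :
  ~~ increments 0 c -> s 0 <= size w ->
  computes_in n (tm_config w o s) d' <->
  exists q s', goes o s n q s' /\ d' = tm_config w q s'.
Proof.
move=> i0; elim: n o s => [|n IH] o s sw /=.
  split=> [<- | [q [s' [h ->]]]]; first by exists o, s; split=> //; apply: Goes0.
  by inversion h.
case: o => [p|].
  have := fun d1 => @machine_step c w p s d1 i0 sw.
  case E: (next (nonzero s) p) => [x o1] h.
  have [h1 sw1] := h (tm_config w o1 (apply_action x s)).
  split.
    move=> [d1 /(h d1).1 -> /IH [] // q [s' [g ->]]]; exists q, s'; split=> //.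
    by apply: GoesS; rewrite E.
  move=> [q [s' [g e]]]; exists (tm_config w o1 (apply_action x s)).
    exact/h1.
  apply/IH => //; exists q, s'; split=> //.
  by move: (goes_someE g); rewrite E.
split=> [[d1 [a]]| [q [s' [g _]]]]; last by inversion g.
by move=> /asboolP.
Qed.

Lemma machine_accepts c w n : ~~ increments 0 c ->
  accepts_in (machine c) w n <->
  exists2 m, n = m.+1 & exists s',
    @goes c (Some (entry c)) (fun r => if r == 0 then size w else 0) m None s'.
Proof.
move=> i0; case: n => [|n]; first by split=> [[d /= <-] | []].
split=> [[d /= [d1 /machine_first_step -> /machine_computes]]|].
  move=> [] // q [s' [g ->]] /= [qE]; subst q.
  by exists n => //; exists s'.
move=> [m [<-] [s' g]]; exists (tm_config w None s') => //.
exists (tm_config w (Some (entry c)) (fun r => if r == 0 then size w else 0)).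
  exact/machine_first_step.
by apply/machine_computes => //; exists None, s'.
Qed.

(** * Coding Turing machines by numbers *)

Definition move_code (m : move) : 'I_3 :=
  match m with MoveLeft => inord 0 | Stay => inord 1 | MoveRight => inord 2 end.
Definition move_decode (i : 'I_3) : move :=
  if i == 0 :> nat then MoveLeft else if i == 1 :> nat then Stay else MoveRight.
Lemma move_codeK : cancel move_code move_decode.
Proof. by case; rewrite /move_decode /= inordK. Qed.
(** With finitely many moves the situations form a finite type, so a machine is coded by listing the
    allowed ones. *)
HB.instance Definition _ := Finite.copy move (can_type move_codeK).

Lemma shift_move_code m : Defs.shift m = (Posz (move_code m) - 1)%R.
Proof. by case: m; rewrite /= inordK. Qed.

(* A command together with the situation where it is applied; [None] means that
   the machine is stuck. *)
Notation situation D :=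
  (state D * {ffun tape_index D -> symbol D} * option (command D))%type.

Definition allowed (D : TM) (x : situation D) : bool :=
  let: (q, v, oa) := x in
  if oa is Some a then trans q v a
  else (q != accept D) && ~~ [exists a, trans q v a].

(** Codes 0 and 1 are fixed to agree with [initial_sym]. *)
Definition sym_code (D : TM) (s : symbol D) : nat :=
  if s == blank D then 0 else if s == letter D true then 1 else (enum_rank s).+2.

(** Code 0 is left free for the missing next state of a stuck situation. *)
Definition state_code (D : TM) (q : state D) : nat :=
  if q == start D then 1 else (enum_rank q).+2.

Lemma sym_code_inj D : injective (@sym_code D).
Proof.
move=> s s'; rewrite /sym_code.
do !case: eqP => [->|_] //.
by move=> /eqP; rewrite !eqSS => /eqP/val_inj/enum_rank_inj.
Qed.

Lemma state_code_inj D : injective (@state_code D).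
Proof.
move=> q q'; rewrite /state_code; do !case: eqP => [->|_] //.
by move=> /eqP; rewrite !eqSS => /eqP/val_inj/enum_rank_inj.
Qed.

Definition fun_code k (f : 'I_k -> nat) : nat := encode [seq f i | i <- enum 'I_k].

Lemma get_fun_code k (f : 'I_k -> nat) (i : 'I_k) : get (fun_code f) i = f i.
Proof.
rewrite /fun_code get_encode (nth_map i) ?size_enum_ord //.
by rewrite nth_ord_enum.
Qed.

Definition situation_code (D : TM) (x : situation D) : nat :=
  let: (q, v, oa) := x in
  let rd := fun_code (fun i => sym_code (v i)) in
  if oa is Some (q', v', d) then
    encode [:: state_code q; state_code q'; rd;
              fun_code (fun i => sym_code (v' i));
              fun_code (fun i => val (move_code (d i)))]
  else encode [:: state_code q; 0; rd; 0; 0].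

Lemma f_stateE D (x : situation D) : f_state (situation_code x) = state_code x.1.1.
Proof. by case: x => [[q v] [[[q' v'] d]|]]; rewrite /f_state get_encode. Qed.

Lemma f_nextE D (x : situation D) : f_next (situation_code x) =
  if x.2 is Some a then state_code a.1.1 else 0.
Proof. by case: x => [[q v] [[[q' v'] d]|]]; rewrite /f_next get_encode. Qed.

Lemma f_readE D (x : situation D) (i : tape_index D) :
  f_read (situation_code x) i = sym_code (x.1.2 i).
Proof.
by case: x => [[q v] [[[q' v'] d]|]]; rewrite /f_read get_encode get_fun_code.
Qed.

Lemma f_writeE D q v q' v' d (i : tape_index D) :
  f_write (@situation_code D (q, v, Some (q', v', d))) i = sym_code (v' i).
Proof. by rewrite /f_write get_encode get_fun_code. Qed.

Lemma f_dirE D q v q' v' d (i : tape_index D) :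
  f_dir (@situation_code D (q, v, Some (q', v', d))) i = move_code (d i).
Proof. by rewrite /f_dir get_encode get_fun_code. Qed.

Definition machine_code (D : TM) : nat :=
  let xs := enum (@allowed D) in
  encode [:: (extra_tapes D).+1; size xs; encode (map (@situation_code D) xs)].

(** Replays the commands recorded in [X] without checking that they apply. *)
Fixpoint config_at (D : TM) (y : nat) (X : nat -> situation D) (u : nat) : config D :=
  if u is u'.+1 then
    if (X u').2 is Some a then perform a (config_at y X u') else config_at y X u'
  else initial D (nseq y true).

Section Trace.
Variables (D : TM) (y : nat) (X : nat -> situation D) (l : nat) (n : nat).
Hypothesis hl : forall u, u < n -> get l u = situation_code (X u).
Hypothesis hX : forall u, u.+1 < n -> (X u).2.

Lemma head_config_at (i : tape_index D) u : u < n ->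
  Defs.head (config_at y X u) i = (Posz (pos l i u) - Posz u)%R.
Proof.
elim: u => [//|u IH] un; have := hX un; have := hl (ltnW un).
have posS : pos l i u.+1 = pos l i u + f_dir (get l u) i by [].
rewrite posS [config_at _ _ _]/=.
case: (X u) => [[q v] [[[q' v'] d]|]] // -> _.
by rewrite f_dirE /= IH ?(ltnW un) // shift_move_code; lia.
Qed.

Lemma content_config_at (i : tape_index D) u z : u < n ->
  sym_code (Defs.content (config_at y X u) i z) =
  prec (sym_code (Defs.content (initial D (nseq y true)) i z))
   (fun k r => if Defs.head (config_at y X k) i == z then f_write (get l k) i else r) u.
Proof.
elim: u => [//|u IH] un; have := hX un; have := hl (ltnW un).
rewrite [prec _ _ u.+1]/= -IH ?(ltnW un) // [config_at _ _ u.+1]/=.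
case: (X u) => [[q v] [[[q' v'] d]|]] // -> _.
by rewrite f_writeE /= eq_sym; case: eqP.
Qed.

Lemma sym_config_at (i : tape_index D) u : u < n ->
  sym_code (scanned (config_at y X u) i) = sym l y i u.
Proof.
move=> un; rewrite ffunE content_config_at //.
have hi : sym_code (Defs.content (initial D (nseq y true)) i (Defs.head (config_at y X u) i)) =
    initial_sym y i (pos l i u) u.
  rewrite head_config_at // /initial_sym /=.
  have -> : (i == ord0) = (i == 0 :> nat) by [].
  case: eqP => _ /=; last by rewrite /sym_code eqxx.
  have -> : (0 <= Posz (pos l i u) - Posz u)%R = (u <= pos l i u) by lia.
  case: (leqP u (pos l i u)) => h /=; last by rewrite /sym_code eqxx.
  rewrite map_nseq nth_nseq.
  have -> : (absz (Posz (pos l i u) - Posz u)%R < y) = (pos l i u < u + y) by lia.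
  by case: ifP => _; rewrite /sym_code ?eqxx // (negbTE (letter_neq_blank _ _)).
rewrite hi /sym.
(* Head positions are [pos] minus the elapsed time; comparing them crosswise avoids subtraction. *)
have : forall m, m <= u -> prec (initial_sym y i (pos l i u) u)
    (fun k r => if Defs.head (config_at y X k) i == Defs.head (config_at y X u) i
       then f_write (get l k) i else r) m =
  prec (initial_sym y i (pos l i u) u)
   (fun k r => if pos l i u + k == pos l i k + u then f_write (get l k) i else r) m.
  elim=> //= m IH mu; rewrite IH ?(ltnW mu) // !head_config_at //; last by lia.
  congr (if _ then _ else _); lia.
exact.
Qed.

End Trace.

(** * Valid traces and rejecting computations *)

Definition rejects (D : TM) (w : seq bool) : Prop :=
  exists n (c : config D), [/\ computes_in n (initial D w) c,
    ~ (exists c', step c c') & cstate c != accept D].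

Lemma computes_in_rcons (D : TM) n (c1 c2 c3 : config D) :
  computes_in n c1 c2 -> step c2 c3 -> computes_in n.+1 c1 c3.
Proof.
elim: n c1 => [|n IH] c1 /=; first by move=> <- h; exists c3.
by move=> [c h1 h2] h3; exists c => //; apply: IH.
Qed.

Lemma computes_in_path (D : TM) n (c c' : config D) : computes_in n c c' ->
  exists g : nat -> config D,
    [/\ g 0 = c, g n = c' & forall u, u < n -> step (g u) (g u.+1)].
Proof.
elim: n c => [|n IH] c /=; first by move=> ->; exists (fun=> c').
move=> [c1 h1 /IH[g [g0 gn hg]]].
exists (fun u => if u is u'.+1 then g u' else c); split=> //.
by case=> [|u] hu; [rewrite g0|apply: hg].
Qed.

Lemma get_machine_code (D : TM) :
  [/\ get (machine_code D) 0 = (extra_tapes D).+1,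
      get (machine_code D) 1 = size (enum (@allowed D)) &
      get (machine_code D) 2 = encode (map (@situation_code D) (enum (@allowed D)))].
Proof. by rewrite /machine_code !get_encode. Qed.

Lemma has_situation_code (D : TM) p :
  has (fun k => get (get (machine_code D) 2) k == p)
    (iota 0 (get (machine_code D) 1)) <->
  exists2 x, @allowed D x & p = situation_code x.
Proof.
have [_ -> ->] := get_machine_code D.
have e k (x : situation D) : k < size (enum (@allowed D)) ->
    get (encode (map (@situation_code D) (enum (@allowed D)))) k = situation_code (nth x (enum (@allowed D)) k).
  by move=> hk; rewrite get_encode (nth_map x).
split=> [/hasP[k]|[x ax ->]].
  rewrite mem_iota add0n /= => hk /eqP <-.
  case E : (enum (@allowed D)) hk => [//|x s]; rewrite -E => hk.
  exists (nth x (enum (@allowed D)) k); last exact: e.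
  by have := mem_nth x hk; rewrite mem_enum.
have xin : x \in enum (@allowed D) by rewrite mem_enum.
apply/hasP; exists (index x (enum (@allowed D))).
  by rewrite mem_iota add0n index_mem.
by rewrite (e _ x) ?index_mem // nth_index.
Qed.

(** The trace has one entry for each step and a last one, without command, for the stuck
    configuration. *)
Lemma rejects_valid (D : TM) y : rejects D (nseq y true) ->
  exists c, valid (machine_code D) y c.
Proof.
move=> [n [c [/computes_in_path[g [g0 gn hg]] stuck nacc]]].
pose P u (oa : option (command D)) :=
  if u < n then exists2 a, oa = Some a & trans (cstate (g u)) (scanned (g u)) a
    /\ g u.+1 = perform a (g u) else oa = None.
have [F hF] : {F : nat -> option (command D) & forall u, P u (F u)}.
  apply: boolp.choice => u; rewrite /P; case: ltnP => un; last by exists None.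
  by have [a h1 h2] := hg u un; exists (Some a), a.
pose X u : situation D := (cstate (g u), scanned (g u), F u).
have atX u : u <= n -> config_at y X u = g u.
  elim: u => [|u IH] un; first by rewrite g0.
  rewrite /= IH ?(ltnW un) //; have := hF u; rewrite /P un => -[a] -> [_ ->] //.
set l := encode [seq situation_code (X u) | u <- iota 0 n.+1].
have hl u : u < n.+1 -> get l u = situation_code (X u).
  by move=> un; rewrite get_encode (nth_map 0) ?size_iota // nth_iota.
have hX u : u.+1 < n.+1 -> (X u).2.
  by rewrite ltnS => un; have := hF u; rewrite /P un /= => -[a] ->.
exists (cpair n.+1 l); rewrite /valid pfstE psndE; apply/and4P; split=> //.
- by rewrite hl // f_stateE /= g0 /state_code eqxx.
- apply/allP => u; rewrite mem_iota add0n /= => un; rewrite /valid_step.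
apply/andP; split.
  apply/has_situation_code; exists (X u); last exact: hl.
  have := hF u; rewrite /P /allowed /=; case: ltnP => h.
    by move=> [a -> []].
  have -> : u = n by lia.
  move=> ->; rewrite gn nacc /=; apply/negP => /existsP[a ha]; apply: stuck.
  by exists (perform a c), a.
apply/andP; split.
  have [-> _ _] := get_machine_code D; apply/allP => i; rewrite mem_iota add0n /= => ik.
  have := f_readE (X u) (Ordinal ik); have := sym_config_at y hl hX (Ordinal ik) un.
  by rewrite hl // atX //= => -> /= ->.
case: ifP => // un'; rewrite !hl // f_nextE f_stateE.
by have := hF u; rewrite /P -ltnS un' /= => -[a -> [_ ->]]; case: a => [[]].
- by rewrite hl // f_nextE /=; have := hF n; rewrite /P ltnn => ->.
Qed.

(** By induction along the replay, each configuration has the recorded state and scanned symbols, so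
    the recorded command applies. The last situation has no command, hence is stuck and not
    accepting. *)
Lemma valid_rejects (D : TM) y c :
  valid (machine_code D) y c -> rejects D (nseq y true).
Proof.
rewrite /valid; set n := pfst c; set l := psnd c.
move=> /and4P[n0 /eqP hstart /allP hstep /eqP hend].
have hs u : u < n -> valid_step (machine_code D) y l n u.
  by move=> un; apply: hstep; rewrite mem_iota.
have ex u : u < n -> exists2 x, @allowed D x & get l u = situation_code x.
  by move=> /hs /andP[/has_situation_code].
have [x0 _ _] := ex 0 n0.
pose P u (x : situation D) := u < n -> @allowed D x /\ get l u = situation_code x.
have [X hX] : {X : nat -> situation D & forall u, P u (X u)}.
  apply: boolp.choice => u; rewrite /P; case: (ltnP u n) => [/ex[x ax e]|_]; last by exists x0.
  by exists x.
have hl u : u < n -> get l u = situation_code (X u) by move=> /hX[].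
(* An entry before the last carries a command, as the code of a state is never 0. *)
have hnext u : u.+1 < n -> exists2 a, (X u).2 = Some a & a.1.1 = (X u.+1).1.1.
  move=> un; have := hs u (ltnW un) => /and3P[_ _]; rewrite un !hl ?(ltnW un) //.
  rewrite f_nextE f_stateE; case: (X u).2 => [a /eqP/state_code_inj e|]; first by exists a.
  by rewrite /state_code; case: ifP.
have hX2 u : u.+1 < n -> (X u).2 by move=> /hnext[a ->].
have hscan u : u < n -> scanned (config_at y X u) = (X u).1.2.
  move=> un; apply/ffunP => i; apply: sym_code_inj; rewrite (sym_config_at y hl hX2) //.
  have := hs u un => /and3P[_ /allP hr _].
  have := hr (i : nat); rewrite mem_iota add0n; have [-> _ _] := get_machine_code D.
  by move=> /(_ (ltn_ord i)); rewrite hl // f_readE => /eqP ->.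
have main u : u < n -> [/\ computes_in u (initial D (nseq y true)) (config_at y X u),
    cstate (config_at y X u) = (X u).1.1 & scanned (config_at y X u) = (X u).1.2].
  move=> un.
  have hsc : scanned (config_at y X u) = (X u).1.2.
    exact: hscan.
  elim: u un hsc => [|u IH] un hsc.
    split=> //; move: hstart; rewrite hl // f_stateE => /= e.
    apply: esym; apply: (@state_code_inj D); rewrite e /state_code eqxx //.
  have un' := ltnW un.
  have hsc' : scanned (config_at y X u) = (X u).1.2 by exact: hscan.
  have [h1 h2 _] := IH un' hsc'.
  have [a ea eq] := hnext u un.
  have hc : config_at y X u.+1 = perform a (config_at y X u) by rewrite /= ea.
  split=> //; last by rewrite hc -eq; case: (a) => [[q v] d].
  apply: (computes_in_rcons h1); rewrite hc; exists a => //.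
  rewrite h2 hsc'; have [+ _] := hX u un'; rewrite /allowed.
  by case: (X u) ea => [[q v] oa] /= ->.
have hn : n.-1 < n by lia.
have [h1 h2 h3] := main _ hn.
have [+ _] := hX _ hn; move: hend; rewrite hl // f_nextE /allowed.
case: (X n.-1) h2 h3 => [[q v] [a|]] /= h2 h3.
  by rewrite /state_code; case: ifP.
move=> _ /andP[nacc stuck]; exists n.-1, (config_at y X n.-1); split=> //.
  by move=> [c' [a]]; rewrite h2 h3 => ha _; case/existsP: stuck; exists a.
by rewrite h2.
Qed.

Lemma machine_code_valid (D : TM) y :
  (exists c, valid (machine_code D) y c) <-> rejects D (nseq y true).
Proof. by split=> [[c /valid_rejects]|/rejects_valid]. Qed.

(** * True stages and good numbers *)

Lemma selects_mono n s m t : selects n s -> selects m t -> n <= m -> s <= t.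
Proof.
move=> [hs _] [_ ht] nm; rewrite leqNgt; apply/negP => /hs h.
by move: (leq_trans h (leq_trans nm ht)); rewrite ltnn.
Qed.

Lemma selects_bnd s : selects (bnd s.+1) s.
Proof. by split=> // j js; apply: bnd_mono. Qed.

Lemma accepts_deficient w s : selects (size w) s ->
  accepts (machine program) w <-> deficient s.
Proof.
move=> hs; split=> [[n /(machine_accepts _ _ increments_program)[m _ [s' h]]]|[t st vt]].
  by apply: (goes_program hs); exists m, s'.
have [T [s' [h _]]] := goes_accept hs st vt.
by exists T.+1; apply/(machine_accepts _ _ increments_program); exists T => //; exists s'.
Qed.

Lemma time_le (M : TM) w (hw : accepts M w) n : accepts_in M w n -> time hw <= n.
Proof.
by move=> h; rewrite /time; case: ex_minnP => k _; apply; apply/asboolP.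
Qed.

(* At a true stage [s], every accepted input selecting an earlier stage has a
   witness of its deficiency no later than [s]. *)
Lemma time_true_stage s w (hw : accepts (machine program) w) :
  ~ deficient s -> size w < bnd s.+1 -> time hw <= 132 * clk s.
Proof.
move=> ts hsize; have [u hu] := selects_ex (size w).
have us := selects_mono hu (selects_bnd s) (ltnW hsize).
have [t ut vt] := (accepts_deficient hu).1 hw.
have lus : u < s.
  rewrite ltn_neqAle us andbT; apply/eqP => e; apply: ts; rewrite -e.
  by exists t.
have [t1 /andP[ut1 t1s] vt1] : exists2 t1, u < t1 <= s & vals t1 < vals u.
  case: (leqP t s) => [le|lst]; first by exists t; rewrite ?ut.
  exists s; first by rewrite lus leqnn.
  apply: contrapT => /negP; rewrite -leqNgt => h.
  by apply: ts; exists t => //; apply: leq_trans vt h.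
have [T [s' [h bT]]] := goes_accept hu ut1 vt1.
apply: (@leq_trans T.+1).
  by apply: time_le; apply/(machine_accepts _ _ increments_program); exists T => //; exists s'.
(* The marking step and the final test are paid for by the extra [2 * clk s]. *)
by have := clk_mono t1s; have := clk_gt0 t1; lia.
Qed.

(** * Undecidability of the language *)

Lemma computes_in_det (M : TM) n m (c c1 c2 : config M) : deterministic M ->
  computes_in n c c1 -> computes_in m c c2 ->
  ~ (exists c', step c1 c') -> ~ (exists c', step c2 c') -> c1 = c2.
Proof.
move=> det h1 h2 st1 st2; elim: n m c h1 h2 => [|n IH] [|m] c /=.
- by move=> -> ->.
- by move=> -> [c' h _]; case: st1; exists c'.
- by move=> [c' h _] e; case: st2; exists c'; rewrite -e.
- move=> [d [a ha ->] h1] [d' [a' ha' ->]]; rewrite -(det _ _ _ _ ha ha').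
  exact: IH.
Qed.

Lemma rejectsP (M : TM) w : deterministic M -> halts M w ->
  rejects M w <-> ~ accepts M w.
Proof.
move=> det [n [c [hc stuck]]]; split=> [[m [d [hd sd nd]] [k [e he ee]]]|nacc].
  have se : ~ (exists c', step e c').
    by move=> [c' [a]]; rewrite ee (negbTE (accept_halts _ _)).
  by move: nd; rewrite (computes_in_det det hd he sd se) ee eqxx.
exists n, c; split=> //; apply/eqP => e; apply: nacc.
by exists n; exists c.
Qed.

(** A decider would reject the word of [bnd s.+1] letters [true] exactly at the true stages [s],
    which [diagonal] forbids for its code. *)
Lemma not_recursive : ~ recursive (language (machine program)).
Proof.
move=> [M [det hM rM]]; apply: (@diagonal (machine_code M)) => s.
rewrite machine_code_valid (rejectsP det (hM _)).
have hs : selects (size (nseq (bnd s.+1) true)) s by rewrite size_nseq; apply: selects_bnd.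
rewrite -(accepts_deficient hs).
have e : accepts (machine program) = accepts M by exact: rM.
by rewrite e.
Qed.

Lemma linear_lt_exp2 A : exists k0, forall k, k0 <= k -> A * k < 2 ^ k.
Proof.
have sq k : 5 <= k -> k * k < 2 ^ k.
  move=> /subnK <-; elim: (k - 5) => // d IH.
  rewrite addSn expnS; nia.
exists (maxn A 5) => k hk; apply: leq_ltn_trans (sq k _); last by lia.
by rewrite leq_mul2r; lia.
Qed.

Local Open Scope ring_scope.

Lemma double_exp_lt_tower (R : realType) (alpha : R) n k :
  alpha * n%:R < (2 ^ k)%N%:R -> double_exp alpha n < (tower k)%:R.
Proof.
have mono (x y : R) : x < y -> (2 : R) `^ x < 2 `^ y.
  move=> xy; rewrite /powR pnatr_eq0 /= ltr_expR ltr_pM2r //.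
  by apply: ln_gt0; rewrite ltr1n.
have pow m : (2 : R) `^ m%:R = (2 ^ m)%N%:R by rewrite powR_mulrn // natrX.
by move=> h; rewrite /double_exp /tower -2!pow; apply/mono/mono.
Qed.

(** By hypothesis [2 ^ clk s] exceeds [alpha] times any relevant acceptance time; two more
    exponentials give [tower (clk s)], which is at most [bnd s.+1]. *)
Lemma good_true_stage (R : realType) (alpha : R) s :
  0 < alpha -> alpha * (132 * clk s)%N%:R < (2 ^ clk s)%N%:R -> ~ deficient s ->
  good (double_exp alpha) (machine program) (bnd s.+1).
Proof.
move=> a0 ha ts w hw sw; apply: lt_le_trans (_ : (tower (clk s))%:R <= _); last first.
  by rewrite ler_nat tower_le_bnd.
apply: double_exp_lt_tower; apply: le_lt_trans ha.
by rewrite ler_pM2l // ler_nat; apply: time_true_stage.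
Qed.

Lemma infinite_unbounded (A : set nat) :
  (forall k, exists2 m, (k <= m)%N & A m) -> infinite_set A.
Proof.
move=> h /finite_seqP[r e]; have [m hm] := h (\max_(i <- r) i).+1.
rewrite e /= => mr.
by have := @leq_bigmax_seq _ r predT id m mr isT; rewrite leqNgt hm.
Qed.

Theorem theorem14p1 (R : realType) :
  exists (M0 : TM) (X : set (seq bool)),
    [/\ recognizes M0 X,
        recursively_enumerable X,
        ~ recursive X &
        forall alpha : R, 0 < alpha ->
          infinite_set [set m : nat | good (double_exp alpha) M0 m]%classic].
Proof.
exists (machine program), (language (machine program)); split=> //.
- by exists (machine program).
- exact: not_recursive.
move=> alpha a0; apply: infinite_unbounded => k.
(* [A] is a natural number above [132 * alpha]; past [k0] the clock meets the condition of
   [good_true_stage]. *)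
set A := (Num.truncn (alpha * 132)).+1.
have [k0 hk0] := linear_lt_exp2 A.
have [s ks ts] := true_stage (maxn k k0).
exists (bnd s.+1); first by have := leq_bnd s.+1; lia.
apply: good_true_stage => //.
have lk : (A * clk s < 2 ^ clk s)%N by apply: hk0; have := leq_clk s; lia.
apply: le_lt_trans (_ : (A * clk s)%N%:R < _); last by rewrite ltr_nat.
rewrite !natrM mulrA ler_wpM2r // ltW //.
by rewrite /A truncnS_gt.
Qed.
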